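(* Let $X:=\mathbb{Z}[\mathrm{i}]^3\backslash(\mathbb{C}^3,* )$ be the real $6$-dimensional manifold underlying the Iwasawa manifold. Then there exists an almost-Kähler structure $(J,\omega,g)$ on $X$ such that $J$ is $\mathcal{C}^\infty$-pure and is not $\mathcal{C}^\infty$-full. Furthermore, the Lefschetz type operator $\mathcal{L}_\omega:=\omega\wedge\cdot\,\colon\wedge^2X\to\wedge^4X$ of this almost-Kähler structure $(J,\omega,g)$ does not take $g$-harmonic $2$-forms to $g$-harmonic $4$-forms (i.e. there is a $g$-harmonic $2$-form $\alpha$ such that $\omega\wedge\alpha$ is not $g$-harmonic).
   Context: The group structure on $\mathbb{C}^3$ is $(z_1,z_2,z_3)*(w_1,w_2,w_3):=(z_1+w_1,\ z_2+w_2,\ z_3+z_1w_2+w_3)$; $\mathbb{Z}[\mathrm{i}]^3$ is a discrete co-compact subgroup acting by left multiplication, and $X$ is the quotient, considered as a compact smooth real manifold. An almost-Kähler structure on a smooth manifold $M$ is a triple $(J,\omega,g)$ where $J$ is a smooth almost-complex structure, $\omega$ is a symplectic form, and $g=\omega(\cdot,J\cdot)$ is a $J$-Hermitian (Riemannian) metric. $J$ induces the decomposition $\wedge^r(M;\mathbb{C})=\bigoplus_{p+q=r}\wedge^{p,q}_JM$ of complex forms. Let $H^{(1,1)}_J(M)_{\mathbb{R}}$ be the subspace of $H^2_{dR}(M;\mathbb{R})$ of classes that admit a $d$-closed real representative of type $(1,1)$, and $H^{(2,0),(0,2)}_J(M)_{\mathbb{R}}$ the subspace of classes that admit a $d$-closed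 real representative in $\wedge^{2,0}_JM\oplus\wedge^{0,2}_JM$. Then $J$ is $\mathcal{C}^\infty$-pure if $H^{(1,1)}_J(M)_{\mathbb{R}}\cap H^{(2,0),(0,2)}_J(M)_{\mathbb{R}}=\{0\}$, and $\mathcal{C}^\infty$-full if $H^2_{dR}(M;\mathbb{R})=H^{(1,1)}_J(M)_{\mathbb{R}}+H^{(2,0),(0,2)}_J(M)_{\mathbb{R}}$. $\wedge^kM$ denotes the space of smooth real $k$-forms; a form is $g$-harmonic if it is harmonic for the Hodge Laplacian of $g$. *)

(* Defs.v *)
From mathcomp Require Import all_boot all_order all_fingroup all_algebra.
From mathcomp Require Import complex.
From mathcomp Require Import all_classical all_reals all_analysis.

Set Implicit Arguments.
Unset Strict Implicit.
Unset Printing Implicit Defensive.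

Import Order.TTheory GRing.Theory Num.Theory.
Import numFieldNormedType.Exports.

Local Open Scope classical_set_scope.
Local Open Scope ring_scope.

(** Tensor calculus on a quotient manifold [M = G \ R^m], [m = n.+1], where [G]
    is a set of diffeomorphisms of [R^m] (in the application, a group acting
    freely and properly discontinuously).  The projection [R^m -> M] is a
    covering and a local diffeomorphism, and [T M = G \ T R^m]; a smooth tensor
    field on [M] is therefore given by a smooth tensor field on [R^m] that is
    preserved by every element of [G].

    Tangent vectors are row vectors, and linear maps act on the right.  The
    arguments of a [k]-form are the [k] rows of a [k x m] matrix. *)

Section QuotientManifold.
Context {R : realType} {n : nat}.
Notation V := 'rV[R]_n.+1.

Fixpoint Ck (k : nat) (f : V -> R) : Prop :=
  if k is k'.+1 then
    (forall x, differentiable f x) /\ (forall v, Ck k' (fun x => 'D_v f x))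
  else forall x, {for x, continuous f}.

Definition smooth_fun (f : V -> R) : Prop := forall k, Ck k f.

Definition kform (k : nat) := V -> 'M[R]_(k, n.+1) -> R.

Definition multilinear_alternating (k : nat) (a : 'M[R]_(k, n.+1) -> R) : Prop :=
  (forall (A B C : 'M[R]_(k, n.+1)) i b c,
     row i A = b *: row i B + c *: row i C ->
     row' i B = row' i A -> row' i C = row' i A ->
     a A = b * a B + c * a C) /\
  (forall (A : 'M[R]_(k, n.+1)) i j, i != j -> row i A = row j A -> a A = 0).

Definition pullback (F : V -> V) (k : nat) (a : kform k) : kform k :=
  fun x A => a (F x) (\matrix_i 'd F x (row i A)).

(** The space of smooth [k]-forms on [G \ R^m]. *)
Definition kforms (G : set (V -> V)) (k : nat) : set (kform k) :=
  [set a | (forall x, multilinear_alternating (a x)) /\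
           (forall A, smooth_fun (fun x => a x A)) /\
           (forall F, G F -> pullback F a = a)].

Definition ext_d (k : nat) (a : kform k) : kform k.+1 :=
  fun x A => \sum_(i < k.+1) (-1) ^+ i * 'D_(row i A) (fun y => a y (row' i A)) x.

Definition wedge_form (p q : nat) (a : kform p) (b : kform q) : kform (p + q) :=
  fun x A => ((p`! * q`!)%:R)^-1 *
    \sum_(s : 'S_(p + q))
      (-1) ^+ s * a x (usubmx (row_perm s A)) * b x (dsubmx (row_perm s A)).

Definition lefschetz (omega a : kform 2) : kform 4 := wedge_form omega a.

Definition closed_form (G : set (V -> V)) (k : nat) : set (kform k) :=
  [set a | kforms G a /\ ext_d a = 0].

(** A de Rham class is a coset of the exact forms; the sum of two classes is
    the sum of the two cosets. *)
Definition dR_class (G : set (V -> V)) (k : nat) (a : kform k.+1) :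
    set (kform k.+1) :=
  [set b | exists2 c : kform k, kforms G c & b = a + ext_d c].

Definition dR_cohomology (G : set (V -> V)) (k : nat) : set (set (kform k.+1)) :=
  [set dR_class G a | a in @closed_form G k.+1].

Definition add_class (k : nat) (c1 c2 : set (kform k)) : set (kform k) :=
  [set a + b | a in c1 & b in c2].

(** Complex forms: [eta.1 + i eta.2], evaluated on complex tangent vectors by
    complex multilinearity. *)

Definition cform (k : nat) : Type := (kform k * kform k)%type.

Definition cforms (G : set (V -> V)) (k : nat) : set (cform k) :=
  [set eta | kforms G eta.1 /\ kforms G eta.2].

Definition complexify (k : nat) (a : kform k) (x : V)
    (A : 'M[R[i]]_(k, n.+1)) : R[i] :=
  \sum_(S : {set 'I_k})
    ('i)%C ^+ #|S| *
    (a x (\matrix_(i, j)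
            if i \in S then complex.Im (A i j) else complex.Re (A i j)))%:C%C.

Definition ceval (k : nat) (eta : cform k) (x : V)
    (A : 'M[R[i]]_(k, n.+1)) : R[i] :=
  complexify eta.1 x A + ('i)%C * complexify eta.2 x A.

Definition realform (k : nat) (a : kform k) : cform k := (a, 0).

(** Almost-complex structures, with [J x] the matrix of [v |-> J v] on row
    vectors. *)

Definition almost_complex (G : set (V -> V)) (J : V -> 'M[R]_n.+1) : Prop :=
  (forall x, J x *m J x = - 1%:M) /\
  (forall i j, smooth_fun (fun x => J x i j)) /\
  (forall F, G F -> forall x v, 'd F x (v *m J x) = 'd F x v *m J (F x)).

Definition T10 (J : V -> 'M[R]_n.+1) (x : V) (v : 'rV[R[i]]_n.+1) : Prop :=
  v *m map_mx (fun r : R => r%:C%C) (J x) = ('i)%C *: v.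

Definition T01 (J : V -> 'M[R]_n.+1) (x : V) (v : 'rV[R[i]]_n.+1) : Prop :=
  v *m map_mx (fun r : R => r%:C%C) (J x) = - ('i)%C *: v.

(** [eta] has type [(p,q)]: it vanishes on every family of vectors of type
    (1,0) (those indexed by [S]) and (0,1) (the others) in which the number of
    vectors of type (1,0) is not [p]. *)
Definition forms_pq (G : set (V -> V)) (J : V -> 'M[R]_n.+1) (p q : nat) :
    set (cform (p + q)) :=
  [set eta | cforms G eta /\
     forall x (A : 'M[R[i]]_(p + q, n.+1)) (S : {set 'I_(p + q)}),
       (forall i, if i \in S then T10 J x (row i A) else T01 J x (row i A)) ->
       #|S| != p -> ceval eta x A = 0].

Definition H11 (G : set (V -> V)) (J : V -> 'M[R]_n.+1) : set (set (kform 2)) :=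
  [set dR_class G a | a in
     [set a | closed_form G a /\ @forms_pq G J 1 1 (realform a)]].

Definition H20_02 (G : set (V -> V)) (J : V -> 'M[R]_n.+1) :
    set (set (kform 2)) :=
  [set dR_class G a | a in
     [set a | closed_form G a /\
        exists eta theta : cform 2,
          [/\ @forms_pq G J 2 0 eta,
              @forms_pq G J 0 2 theta &
              realform a = (eta.1 + theta.1, eta.2 + theta.2)]]].

Definition Cinf_pure (G : set (V -> V)) (J : V -> 'M[R]_n.+1) : Prop :=
  H11 G J `&` H20_02 G J = [set dR_class G (0 : kform 2)].

Definition Cinf_full (G : set (V -> V)) (J : V -> 'M[R]_n.+1) : Prop :=
  @dR_cohomology G 1 = [set add_class c1 c2 | c1 in H11 G J & c2 in H20_02 G J].

(** Riemannian metrics, with [g x] the Gram matrix at [x]. *)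

Definition dotg (g : V -> 'M[R]_n.+1) (x u v : V) : R :=
  (u *m g x *m v^T) 0 0.

Definition riemannian (G : set (V -> V)) (g : V -> 'M[R]_n.+1) : Prop :=
  (forall i j, smooth_fun (fun x => g x i j)) /\
  (forall x u v, dotg g x u v = dotg g x v u) /\
  (forall x u, u != 0 -> 0 < dotg g x u u) /\
  (forall F, G F -> forall x u v,
     dotg g (F x) ('d F x u) ('d F x v) = dotg g x u v).

Definition two_vectors (u v : V) : 'M[R]_(2, n.+1) := @col_mx R 1 1 n.+1 u v.

Definition symplectic (G : set (V -> V)) (omega : kform 2) : Prop :=
  closed_form G omega /\
  forall x u, (forall v : V, omega x (two_vectors u v) = 0) -> u = 0.

Definition almost_Kahler (G : set (V -> V)) (J : V -> 'M[R]_n.+1)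
    (omega : kform 2) (g : V -> 'M[R]_n.+1) : Prop :=
  [/\ almost_complex G J,
      symplectic G omega,
      riemannian G g,
      (forall x u v, dotg g x (u *m J x) (v *m J x) = dotg g x u v) &
      (forall x u v, dotg g x u v = omega x (two_vectors u (v *m J x)))].

(** In coordinates,
    [(hodge_star a)_(j_1 .. j_l) =
       1/k! sqrt(det g) a^(i_1 .. i_k) eps_(i_1 .. i_k j_1 .. j_l)], [k + l = m],
    which is characterised by [b /\ hodge_star a = <b, a> vol].  When
    [k + l <> m] the value is zero, because [conform_mx] then returns the zero
    matrix; so [codiff] and [hodge_laplacian] need no degree side conditions. *)
Definition hodge_star (g : V -> 'M[R]_n.+1) (k l : nat) (a : kform k) : kform l :=
  fun x B => (k`!%:R)^-1 *
    \sum_(f : {ffun 'I_k -> 'I_n.+1})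
      a x (rowsub f (invmx (g x))) *
      (Num.sqrt (\det (g x)) *
       \det (conform_mx (0 : 'M[R]_n.+1) (col_mx (rowsub f (1%:M : 'M[R]_n.+1)) B))).

(** On [p]-forms, [d^* = (-1)^(m (p + 1) + 1) hodge_star d hodge_star]; here
    [p = k.+1]. *)
Definition codiff (g : V -> 'M[R]_n.+1) (k : nat) (a : kform k.+1) : kform k :=
  fun x A => (-1) ^+ (n.+1 * k.+2 + 1) *
    @hodge_star g _ k (ext_d (@hodge_star g _ (n.+1 - k.+1) a)) x A.

Definition hodge_laplacian (g : V -> 'M[R]_n.+1) (k : nat) : kform k -> kform k :=
  match k with
  | 0 => fun a => codiff g (ext_d a)
  | k'.+1 => fun a => ext_d (codiff g a) + codiff g (ext_d a)
  end.

Definition harmonic_form (G : set (V -> V)) (g : V -> 'M[R]_n.+1) (k : nat) :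
    set (kform k) :=
  [set a | kforms G a /\ hodge_laplacian g a = 0].

End QuotientManifold.

Section Iwasawa.
Context {R : realType}.

Definition heis_mul (z w : 'rV[R[i]]_3) : 'rV[R[i]]_3 :=
  \row_j (if j == 2%N :> nat
          then z 0 j + z 0 (inord 0) * w 0 (inord 1) + w 0 j
          else z 0 j + w 0 j).

Definition gaussian_lattice : set 'rV[R[i]]_3 :=
  [set a | forall j, complex.Re (a 0 j) \is a Num.int /\
                     complex.Im (a 0 j) \is a Num.int].

(** Underlying real coordinates [(Re z1, Im z1, Re z2, Im z2, Re z3, Im z3)]. *)
Definition toC3 (x : 'rV[R]_6) : 'rV[R[i]]_3 :=
  \row_j (x 0 (inord j.*2) +i* x 0 (inord j.*2.+1))%C.

Definition ofC3 (z : 'rV[R[i]]_3) : 'rV[R]_6 :=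
  \row_k (if odd k then complex.Im (z 0 (inord k./2))
          else complex.Re (z 0 (inord k./2))).

(** [X = iwasawa_deck \ R^6]. *)
Definition iwasawa_deck : set ('rV[R]_6 -> 'rV[R]_6) :=
  [set (fun x => ofC3 (heis_mul a (toC3 x))) | a in gaussian_lattice].

End Iwasawa.

(* Main.v *)
Require Import Defs.
From HB Require Import structures.
From mathcomp Require Import all_boot all_order all_fingroup all_algebra.
From mathcomp Require Import complex.
From mathcomp Require Import ring lra zify.
From mathcomp Require Import all_classical all_reals all_analysis.

Set Implicit Arguments.
Unset Strict Implicit.
Unset Printing Implicit Defensive.

Import Order.TTheory GRing.Theory Num.Theory.
Import numFieldNormedType.Exports.

Local Open Scope classical_set_scope.
Local Open Scope ring_scope.

(** Write [E_0, ..., E_5] for the left-invariant vector fields on [C^3 = R^6]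
    whose dual coframe [e^0, ..., e^5] is given by [dz_1 = e^0 + i e^1],
    [dz_2 = e^2 + i e^3] and [dz_3 - z_1 dz_2 = e^4 + i e^5]; then [e^0, ..., e^3]
    are closed, [d e^4 = - e^02 + e^13] and [d e^5 = - e^03 - e^12].  The structure
    is left-invariant: the frame is orthonormal, [omega = e^05 + e^14 + e^23] and
    [J E_0 = E_5], [J E_1 = E_4], [J E_2 = E_3].

    The only global fact about [X] is that [\int_X E_i h = 0], and that a
    nonnegative function with zero integral vanishes.  Integrals are replaced by
    Riemann sums over the grid of step [1/N] in the unit cube.  A step along a
    coordinate direction permutes the grid modulo the lattice ([mean_shift]), so
    the sums of the difference quotients of [h] vanish exactly and those of [E_i h]
    are [O(1/N)] ([null_mean_frame_derive]); on the other hand a nonnegative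
    function that is positive somewhere has Riemann sums bounded away from zero
    ([null_mean_eq0]).

    Purity.  A closed form [b] of type (2,0)+(0,2) is coclosed, because its Hodge
    dual is [b /\ omega]; here this is read off from the components of [d b]
    ([divergence_antiinv]).  If [b = a + d c] with [a] of type (1,1), then [a] is
    pointwise orthogonal to [b], so [|b|^2 = <b, d c>] is a divergence
    ([energy_identity]), has zero integral, and [b = 0].

    Not full.  Suppose that [e^01 = a + b + d c] with [a] of type (1,1) and [b] of
    type (2,0)+(0,2), both closed.  The components of [d c] on [(E_0, E_1)] and
    those of [a] and [b] on [(E_4, E_5)] are divergences, the latter because [e^0123]
    is exact.  By the types [a_01 = - a_45] and [b_01 = b_45], so that 1, the
    [(E_0, E_1)]-component of [e^01], has zero integral ([not_sum_of_types]).

    Lefschetz operator.  The forms [e^01] and [* e^01 = e^2345 = dx_2 dx_3 dx_4 dx_5]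
    have constant coefficients in the coordinates, hence [e^01] is harmonic.  But
    [omega /\ e^01 = e^0123] is exact; explicitly [* e^0123 = e^45] is not closed, and
    [d d^* e^0123] takes the value 4 on the first four coordinate vectors at the
    origin ([hodge_laplacian_e0123_neq0]). *)

(** * Smooth functions *)

Section SmoothFunctions.
Context {R : realType} {n : nat}.
Notation V := 'rV[R]_n.+1.
Implicit Types (f g : V -> R) (x v : V).

Lemma smooth_differentiable f x : smooth_fun f -> differentiable f x.
Proof. by move=> sf; case: (sf 1%N) => df _; exact: df. Qed.

Lemma smooth_continuous f : smooth_fun f -> continuous f.
Proof. by move=> sf; exact: (sf 0%N). Qed.

Lemma smooth_derive f v : smooth_fun f -> smooth_fun (fun x => 'D_v f x).
Proof. by move=> sf k; case: (sf k.+1) => _; apply. Qed.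

Lemma smooth_is_derive f x v : smooth_fun f -> is_derive x v f ('D_v f x).
Proof.
by move=> sf; apply: derivableP; apply: diff_derivable; exact: smooth_differentiable.
Qed.

Lemma Ck_le k f : Ck k.+1 f -> Ck k f.
Proof.
elim: k f => [f [df _] x|k IH f [df Df]].
  exact: differentiable_continuous.
by split=> // v; apply: IH; exact: Df.
Qed.

Lemma Ck_cst k (a : R) : Ck k (fun _ : V => a).
Proof.
elim: k a => [a x|k IH a]; first exact: cst_continuous.
split=> [x|v]; first exact: differentiable_cst.
rewrite [X in Ck k X](_ : _ = fun=> 0); first exact: IH.
by apply/funext => x; exact: derive_cst.
Qed.

Lemma Ck_add k f g : Ck k f -> Ck k g -> Ck k (fun x => f x + g x).
Proof.
elim: k f g => [f g cf cg x|k IH f g [df Df] [dg Dg]].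
  by apply: continuousD; [exact: cf|exact: cg].
split=> [x|v]; first exact: differentiableD.
rewrite [X in Ck k X](_ : _ = fun x => 'D_v f x + 'D_v g x); first exact: (IH _ _ (Df v) (Dg v)).
by apply/funext => x; rewrite deriveD //; apply: diff_derivable.
Qed.

(** The Leibniz rule also multiplies by the underived factors, so the induction
    needs [Ck_le]. *)
Lemma Ck_mul k f g : Ck k f -> Ck k g -> Ck k (fun x => f x * g x).
Proof.
elim: k f g => [f g cf cg x|k IH f g Cf Cg].
  by apply: continuousM; [exact: cf|exact: cg].
have [[df Df] [dg Dg]] := (Cf, Cg).
split=> [x|v]; first exact: differentiableM.
rewrite [X in Ck k X](_ : _ = fun x => f x * 'D_v g x + g x * 'D_v f x).
  by apply: Ck_add; [exact: (IH _ _ (Ck_le Cf) (Dg v))|exact: (IH _ _ (Ck_le Cg) (Df v))].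
by apply/funext => x; rewrite deriveM //; apply: diff_derivable.
Qed.

Lemma smooth_cst (a : R) : smooth_fun (fun _ : V => a).
Proof. by move=> k; exact: Ck_cst. Qed.

Lemma smooth_add f g :
  smooth_fun f -> smooth_fun g -> smooth_fun (fun x => f x + g x).
Proof. by move=> sf sg k; exact: Ck_add. Qed.

Lemma smooth_mul f g :
  smooth_fun f -> smooth_fun g -> smooth_fun (fun x => f x * g x).
Proof. by move=> sf sg k; exact: Ck_mul. Qed.

Lemma smooth_opp f : smooth_fun f -> smooth_fun (fun x => - f x).
Proof.
move=> sf; rewrite [X in smooth_fun X](_ : _ = fun x => -1 * f x).
  by apply: smooth_mul => //; exact: smooth_cst.
by apply/funext => x; rewrite mulN1r.
Qed.

Lemma smooth_sub f g :
  smooth_fun f -> smooth_fun g -> smooth_fun (fun x => f x - g x).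
Proof. by move=> sf sg; apply: smooth_add => //; exact: smooth_opp. Qed.

Lemma smooth_sum (I : Type) (r : seq I) (F : I -> V -> R) :
  (forall i, smooth_fun (F i)) -> smooth_fun (fun x => \sum_(i <- r) F i x).
Proof.
move=> sF; elim: r => [|i r IH].
  rewrite [X in smooth_fun X](_ : _ = fun=> 0); first exact: smooth_cst.
  by apply/funext => x; rewrite big_nil.
rewrite [X in smooth_fun X](_ : _ = fun x => F i x + \sum_(j <- r) F j x).
  exact: smooth_add.
by apply/funext => x; rewrite big_cons.
Qed.

Lemma smooth_prod (I : Type) (r : seq I) (F : I -> V -> R) :
  (forall i, smooth_fun (F i)) -> smooth_fun (fun x => \prod_(i <- r) F i x).
Proof.
move=> sF; elim: r => [|i r IH].
  rewrite [X in smooth_fun X](_ : _ = fun=> 1); first exact: smooth_cst.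
  by apply/funext => x; rewrite big_nil.
rewrite [X in smooth_fun X](_ : _ = fun x => F i x * \prod_(j <- r) F j x).
  exact: smooth_mul.
by apply/funext => x; rewrite big_cons.
Qed.

Lemma is_derive_coord (j : 'I_n.+1) x v : is_derive x v (fun y : V => y 0 j) (v 0 j).
Proof.
apply: DeriveDef; first exact/diff_derivable/differentiable_coord.
rewrite deriveE; last exact: differentiable_coord.
pose f (y : V) : R := y 0 j.
have lf : linear f by move=> a u w; rewrite /f !mxE.
pose fM := GRing.isLinear.Build _ _ _ _ _ lf.
pose fL : {linear V -> R} := HB.pack f fM.
by rewrite (_ : (fun y : V => y 0 j) = fL) // diff_lin //; exact: coord_continuous.
Qed.

Lemma smooth_coord (j : 'I_n.+1) : smooth_fun (fun x : V => x 0 j).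
Proof.
case=> [|k]; first by move=> x; exact: coord_continuous.
split=> [x|v]; first exact: differentiable_coord.
rewrite [X in Ck k X](_ : _ = fun=> v 0 j); first exact: Ck_cst.
by apply/funext => x; have := is_derive_coord j x v => H; exact: derive_val.
Qed.

Lemma smooth_det k (M : V -> 'M[R]_k) :
  (forall i j, smooth_fun (fun x => M x i j)) ->
  smooth_fun (fun x => \det (M x)).
Proof.
move=> sM; rewrite /determinant; apply: smooth_sum => s; apply: smooth_mul.
  exact: smooth_cst.
by apply: smooth_prod => i; exact: sM.
Qed.

Lemma is_derive_add f g x v a b :
  is_derive x v f a -> is_derive x v g b ->
  is_derive x v (fun y => f y + g y) (a + b).
Proof. by move=> ? ?; exact: is_deriveD. Qed.

Lemma is_derive_opp f x v a :
  is_derive x v f a -> is_derive x v (fun y => - f y) (- a).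
Proof. by move=> ?; exact: is_deriveN. Qed.

Lemma is_derive_mul f g x v a b :
  is_derive x v f a -> is_derive x v g b ->
  is_derive x v (fun y => f y * g y) (a * g x + f x * b).
Proof.
by move=> ? ?; rewrite addrC [a * _]mulrC; exact: is_deriveM.
Qed.

Lemma is_derive_bigsum (I : Type) (r : seq I) (F : I -> V -> R) x v (D : I -> R) :
  (forall i, is_derive x v (F i) (D i)) ->
  is_derive x v (fun y => \sum_(i <- r) F i y) (\sum_(i <- r) D i).
Proof.
move=> dF; elim: r => [|i r IH].
  rewrite big_nil [X in is_derive _ _ X _](_ : _ = cst 0); first exact: is_derive_cst.
  by apply/funext => y; rewrite big_nil.
rewrite big_cons [X in is_derive _ _ X _](_ : _ = fun y => F i y + \sum_(j <- r) F j y).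
  exact: is_derive_add.
by apply/funext => y; rewrite big_cons.
Qed.

Lemma derive_lin f x u v (a b : R) : smooth_fun f ->
  'D_(a *: u + b *: v) f x = a * 'D_u f x + b * 'D_v f x.
Proof.
by move=> sf; rewrite !deriveE; try exact: smooth_differentiable; rewrite linearD !linearZ.
Qed.

End SmoothFunctions.

(** * The invariant frame and the deck group *)

Section Frame.
Context {R : realType}.
Notation V := 'rV[R]_6.
Implicit Types (x y u v a : V).

Definition coord (x : V) (k : nat) : R := x 0 (inord k).

Lemma coordE x (j : 'I_6) : x 0 j = coord x j.
Proof. by rewrite /coord inord_val. Qed.

Lemma ord6_ind (Q : 'I_6 -> Prop) :
  Q (inord 0) -> Q (inord 1) -> Q (inord 2) -> Q (inord 3) -> Q (inord 4) ->
  Q (inord 5) -> forall j, Q j.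
Proof.
move=> Q0 Q1 Q2 Q3 Q4 Q5 j; rewrite -[j]inord_val.
by case: j => -[|[|[|[|[|[|//]]]]]] ?.
Qed.

Lemma sum6 (F : 'I_6 -> R) : \sum_j F j =
  F (inord 0) + F (inord 1) + F (inord 2) + F (inord 3) + F (inord 4) + F (inord 5).
Proof.
rewrite !big_ord_recr big_ord0 /= add0r.
by do ![congr (_ + _)]; congr F; apply: val_inj; rewrite /= ?inordK.
Qed.

Lemma coordD x y k : coord (x + y) k = coord x k + coord y k.
Proof. by rewrite /coord mxE. Qed.

Lemma coordN x k : coord (- x) k = - coord x k.
Proof. by rewrite /coord mxE. Qed.

Lemma coordZ (t : R) x k : coord (t *: x) k = t * coord x k.
Proof. by rewrite /coord mxE. Qed.

(** [nilp u] is the nilpotent part of left translation by [u]: the real form of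
    [w |-> (0, 0, u_1 * w_2)] on [C^3]. *)
Definition nilp (u : V) : 'M[R]_6 :=
  \matrix_(i, j) match nat_of_ord i, nat_of_ord j with
                 | 2, 4 => coord u 0 | 2, 5 => coord u 1
                 | 3, 4 => - coord u 1 | 3, 5 => coord u 0
                 | _, _ => 0
                 end.

Lemma coord_nilp u y k : (k < 6)%N -> coord (u *m nilp y) k =
  match k with
  | 4 => coord u 2 * coord y 0 - coord u 3 * coord y 1
  | 5 => coord u 2 * coord y 1 + coord u 3 * coord y 0
  | _ => 0 end.
Proof.
move=> k6; rewrite {1}/coord mxE sum6 !mxE !inordK // -!/(coord _ _).
by move: k k6 => [|[|[|[|[|[|//]]]]]] _ /=; ring.
Qed.

Lemma row_eq u v : (forall k, (k < 6)%N -> coord u k = coord v k) -> u = v.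
Proof. by move=> uv; apply/rowP => j; rewrite !coordE uv. Qed.

Lemma nilpD u v : nilp (u + v) = nilp u + nilp v.
Proof.
apply/matrixP => i j; rewrite !mxE !coordD.
by move: (nat_of_ord i) (nat_of_ord j) => [|[|[|[|k]]]] [|[|[|[|[|[|l]]]]]]; ring.
Qed.

Lemma nilpZ (t : R) u : nilp (t *: u) = t *: nilp u.
Proof.
apply/matrixP => i j; rewrite !mxE !coordZ.
by move: (nat_of_ord i) (nat_of_ord j) => [|[|[|[|k]]]] [|[|[|[|[|[|l]]]]]]; ring.
Qed.

Lemma nilp_mul u v : nilp u *m nilp v = 0.
Proof.
apply/matrixP => i j; rewrite !mxE sum6 !mxE !inordK //.
by move: (nat_of_ord i) (nat_of_ord j) => [|[|[|[|k]]]] [|[|[|[|[|[|l]]]]]]; ring.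
Qed.

Lemma nilp_eq u v :
  coord u 0 = coord v 0 -> coord u 1 = coord v 1 -> nilp u = nilp v.
Proof. by rewrite /nilp => -> ->. Qed.

Lemma nilp_nilp u v : nilp (u *m nilp v) = 0.
Proof.
apply/matrixP => i j; rewrite !mxE !coord_nilp //.
by move: (nat_of_ord i) (nat_of_ord j) => [|[|[|[|k]]]] [|[|[|[|[|[|l]]]]]]; ring.
Qed.

(** The rows of [frame x] are the left-invariant vector fields [E_i] at [x], and
    [u *m coframe x] lists the values of the dual forms [e^i] on [u]. *)
Definition frame (x : V) : 'M[R]_6 := 1%:M + nilp x.

Definition coframe (x : V) : 'M[R]_6 := 1%:M - nilp x.

Lemma frameK x : frame x *m coframe x = 1%:M.
Proof.
by rewrite /frame /coframe mulmxBr mulmx1 mulmxDl mul1mx nilp_mul addr0 addrK.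
Qed.

Lemma coframeK x : coframe x *m frame x = 1%:M.
Proof. exact/mulmx1C/frameK. Qed.

Lemma det_frame x : \det (frame x) = 1.
Proof.
rewrite -det_tr det_trig.
  rewrite big1 // => i _; rewrite !mxE eqxx.
  by move: (nat_of_ord i) => [|[|[|[|[|[|l]]]]]]; rewrite addr0.
apply/is_trig_mxP => i j; rewrite !mxE => ij; rewrite -val_eqE gtn_eqF // add0r.
by move: (nat_of_ord i) (nat_of_ord j) ij => [|[|[|[|[|[|l]]]]]] [|[|[|[|k]]]].
Qed.

(** Left translation by [a] in the real coordinates. *)
Definition ltrans (a x : V) : V := a + x *m frame a.

Lemma nilp_ltrans a x : nilp (ltrans a x) = nilp a + nilp x.
Proof.
by rewrite /ltrans /frame mulmxDr mulmx1 !nilpD nilp_nilp addr0.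
Qed.

Lemma frame_ltrans a x : frame x *m frame a = frame (ltrans a x).
Proof.
rewrite /frame nilp_ltrans mulmxDr mulmx1 mulmxDl mul1mx nilp_mul addr0.
by rewrite -addrA [nilp x + _]addrC.
Qed.

Lemma coframe_ltrans a x : frame a *m coframe (ltrans a x) = coframe x.
Proof.
rewrite -[LHS]mul1mx -(coframeK x) -mulmxA (mulmxA (frame x)).
by rewrite frame_ltrans frameK mulmx1.
Qed.

Definition integral_vector : set V := [set a | forall k, (k < 6)%N -> coord a k \is a Num.int].

Lemma ofC3_heis_mul (a : 'rV[R[i]]_3) x :
  ofC3 (heis_mul a (toC3 x)) = ltrans (ofC3 a) x.
Proof.
apply: row_eq => k k6; rewrite /ltrans /frame mulmxDr mulmx1 !coordD coord_nilp //.
have k3 : (k./2 < 3)%N by lia.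
rewrite /coord !mxE !inordK //.
move: k k6 {k3} => [|[|[|[|[|[|//]]]]]] _; rewrite /= ?mxE ?inordK //=.
all: try by case: (a _ (inord 0)) => ? ?; case: (a _ _) => ? ? /=; ring.
all: try by case: (a _ _) => ? ? /=; ring.
Qed.

Lemma iwasawa_deckP (F : V -> V) :
  iwasawa_deck F <-> exists2 a, integral_vector a & F = ltrans a.
Proof.
split=> [[a Za <-]|[a Za ->]].
  exists (ofC3 a); last by apply/funext => x; exact: ofC3_heis_mul.
  by move=> k k6; rewrite /coord mxE; case: ifP => _; case: (Za (inord (inord k : 'I_6)./2)).
exists (toC3 a) => [j|].
  by rewrite /toC3 !mxE /=; split; apply: Za; case: j => -[|[|[|]]].
apply/funext => x; rewrite ofC3_heis_mul; congr ltrans.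
apply: row_eq => k k6; rewrite /coord mxE inordK //.
by move: k k6 => [|[|[|[|[|[|//]]]]]] _; rewrite /= mxE inordK.
Qed.

End Frame.

(** * Riemann sums over the unit cube *)

Section RiemannSums.
Context {R : realType}.
Notation V := 'rV[R]_6.
Implicit Types (h : V -> R) (x y a : V).

Definition basisv (k : nat) : V := delta_mx 0 (inord k).

Lemma coord_basisv k i : (k < 6)%N -> (i < 6)%N -> coord (basisv k) i = (i == k)%:R.
Proof.
move=> k6 i6; rewrite /coord mxE eqxx /=; congr (_%:R); congr nat_of_bool.
by rewrite -val_eqE /= !inordK.
Qed.

Definition grid (N : nat) (f : {ffun 'I_6 -> 'I_N}) : V :=
  \row_j ((f j)%:R / N%:R).

(** The Riemann sum of [h] over the unit cube for the grid of step [1/N]. *)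
Definition mean (N : nat) (h : V -> R) : R :=
  (N%:R^-1) ^+ 6 * \sum_(f : {ffun 'I_6 -> 'I_N}) h (grid f).

Lemma coord_grid N (f : {ffun 'I_6 -> 'I_N}) k : coord (grid f) k = (f (inord k))%:R / N%:R.
Proof. by rewrite /coord mxE. Qed.

(** The index of the grid point one step further in the direction [k], brought
    back to the unit cube by the lattice. *)
Definition cell_bump n k (f : {ffun 'I_6 -> 'I_n.+1}) : {ffun 'I_6 -> 'I_n.+1} :=
  [ffun i : 'I_6 => if i == k :> nat then f i + inZp 1
    else f i + (if f (inord k) == ord_max then
      match k, nat_of_ord i with
      | 0, 4 => - f (inord 2)
      | 0, 5 => - f (inord 3)
      | 1, 4 => f (inord 3)
      | 1, 5 => - f (inord 2)
      | _, _ => 0 end else 0)].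

Lemma cell_bump_inj n k : (k < 6)%N -> injective (@cell_bump n k).
Proof.
move=> k6 f g /ffunP fg.
have fgk : f (inord k) = g (inord k).
  by have := fg (inord k); rewrite !ffunE inordK // eqxx => /addIr.
have fg23 i : (i < 4)%N -> i != k -> f (inord i) = g (inord i).
  move=> i4 ik; have i6 : (i < 6)%N by lia.
  have := fg (inord i); rewrite !ffunE inordK // (negPf ik) fgk.
  case: ifP => _; last exact: addIr.
  by move: i i4 {ik i6} => [|[|[|[|//]]]] _; case: k {k6 fgk fg} => [|[|?]] /=; rewrite !addr0.
apply/ffunP => i; have := fg i; rewrite !ffunE fgk.
case: ifP => [_ /addIr //|_]; case: ifP => _; last exact: addIr.
case: k k6 {fg fgk} fg23 => [|[|k]] k6 fg23; try by rewrite !addr0.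
all: case: i => -[|[|[|[|[|[|//]]]]]] i6 /=; rewrite ?addr0 //.
all: by rewrite fg23 // => /addIr.
Qed.

Lemma Zp_frac n (b c : 'I_n.+1) :
  (val (b + c)%R)%:R / n.+1%:R - (b%:R / n.+1%:R + c%:R / n.+1%:R) \is a @Num.int R.
Proof.
have n0 : n.+1%:R != 0 :> R by rewrite pnatr_eq0.
have -> : b%:R / n.+1%:R + c%:R / n.+1%:R = (b + c)%N%:R / n.+1%:R :> R.
  by rewrite natrD mulrDl.
rewrite /= {2}(divn_eq (b + c) n.+1) [in X in _ - X]natrD mulrDl natrM mulfK //.
rewrite opprD addrCA subrr addr0.
by rewrite rpredN natr_int.
Qed.

Lemma Zp_fracN n (b : 'I_n.+1) :
  (val (- b)%R)%:R / n.+1%:R + b%:R / n.+1%:R \is a @Num.int R.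
Proof.
have := Zp_frac (- b) b; rewrite addNr /= mul0r sub0r rpredN; exact.
Qed.

Lemma coord_nilp_diag x k : (k < 6)%N -> coord (x *m nilp (basisv k)) k = 0.
Proof.
move=> k6; rewrite coord_nilp //.
by move: k k6 => [|[|[|[|[|[|//]]]]]] k6; rewrite ?coord_basisv //=; ring.
Qed.

Lemma Zp_fracB n (b c : 'I_n.+1) :
  (val (b - c)%R)%:R / n.+1%:R - (b%:R / n.+1%:R - c%:R / n.+1%:R) \is a @Num.int R.
Proof.
have := rpredD (Zp_frac b (- c)) (Zp_fracN c).
set p := (val (b - c))%:R / _; set q := (val (- c))%:R / _.
by rewrite (_ : p - _ + (q + _) = p - (b%:R / n.+1%:R - c%:R / n.+1%:R)) //; ring.
Qed.

(** Moving the grid by one step in the direction [k] permutes it modulo the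
    lattice; a point that leaves the cube comes back through the face
    [x_k = 0], which left translation by the [k]-th basis vector glues to the
    face [x_k = 1] after a shear in the directions 4 and 5. *)
Lemma mean_shift N k h : (0 < N)%N -> (k < 6)%N ->
  (forall x, h (x + basisv k) = h (x - x *m nilp (basisv k))) ->
  ((k < 2)%N -> forall x a, integral_vector a ->
     (forall i, (i < 4)%N -> coord a i = 0) -> h (x + a) = h x) ->
  mean N (fun x => h (x + N%:R^-1 *: basisv k)) = mean N h.
Proof.
case: N => // n _ k6 hk hper; rewrite /mean; congr (_ * _).
have n0 : n.+1%:R != 0 :> R by rewrite pnatr_eq0.
rewrite [RHS](reindex_inj (@cell_bump_inj n k k6)).
apply: eq_bigr => f _; case: (eqVneq (f (inord k)) ord_max) => fk; last first.
  congr h; apply: row_eq => i i6.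
  rewrite coordD coordZ coord_basisv // !coord_grid !ffunE (negPf fk) !inordK //.
  case: eqP => [->|_]; last by rewrite mulr0 !addr0.
  rewrite mulr1 -[X in _ + X]mul1r -mulrDl -(natrD _ _ 1); congr (_%:R / _).
  rewrite /= modnDmr modn_small // addn1 ltnS ltn_neqAle -ltnS ltn_ord andbT.
  by apply: contraNneq fk => fk; apply/eqP/val_inj.
(* [y] is the point of the face [x_k = 0] below the grid point. *)
pose y := grid f - (n%:R / n.+1%:R) *: basisv k.
have -> : grid f + n.+1%:R^-1 *: basisv k = y + basisv k.
  apply: row_eq => i i6; rewrite /y !(coordD, coordN, coordZ) -natr1.
  by field; rewrite natr1.
rewrite hk.
set z := y - _; set w := grid _.
have wE i : (i < 6)%N -> coord w i - coord z i =
    (val (cell_bump k f (inord i)))%:R / n.+1%:R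
    - ((f (inord i))%:R / n.+1%:R - (n%:R / n.+1%:R) * (i == k)%:R
       - coord (y *m nilp (basisv k)) i).
  by move=> i6; rewrite /w /z /y !(coordD, coordN) coord_grid coord_grid coordZ coord_basisv.
have yE i : (i < 6)%N -> i != k -> coord y i = (f (inord i))%:R / n.+1%:R.
  by move=> i6 ik; rewrite /y coordD coordN coordZ coord_basisv // (negPf ik) mulr0 subr0 coord_grid.
have wzk : coord w k = coord z k.
  apply/eqP; rewrite -subr_eq0 wE // eqxx mulr1 ffunE inordK // eqxx fk /= modnDmr addn1.
  by rewrite modnn mul0r subrr !sub0r opprK coord_nilp_diag.
have wz i : (i < 4)%N -> coord w i = coord z i.
  move=> i4; case: (eqVneq i k) => [->//|ik]; have i6 : (i < 6)%N by lia.
  apply/eqP; rewrite -subr_eq0 wE // ffunE inordK // (negPf ik) fk eqxx mulr0 coord_nilp //.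
  have -> : match k, i return 'I_n.+1 with
            | 0, 4 => - f (inord 2) | 0, 5 => - f (inord 3)
            | 1, 4 => f (inord 3) | 1, 5 => - f (inord 2) | _, _ => 0 end = 0.
    by move: k i i4 {hk hper k6 fk y z w wE yE wzk ik i6} => [|[|?]] [|[|[|[|//]]]].
  rewrite addr0 (_ : match i with 4 => _ | 5 => _ | _ => _ end = 0).
    by rewrite !subr0 subrr.
  by move: i i4 {ik i6} => [|[|[|[|//]]]].
case: (ltnP k 2) => k2; last first.
  congr h; apply: row_eq => i i6; case: (ltnP i 4) => i4; first by rewrite wz.
  case: (eqVneq i k) => [->//|ik].
  apply/eqP; rewrite eq_sym -subr_eq0 wE // ffunE inordK // (negPf ik) fk eqxx mulr0 coord_nilp //.
  rewrite !coord_basisv // ![in _ == k]eq_sym !(gtn_eqF k2, gtn_eqF (ltnW k2)) /=.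
  rewrite (_ : match k with 0 => _ | _ => _ end = 0); last first.
    by move: k k2 {k6 hk hper fk y z w wE yE wzk wz ik} => [|[|?]].
  rewrite addn0 (modn_small (ltn_ord _)) (_ : match i with 4 => _ | 5 => _ | _ => _ end = 0).
    by rewrite !subr0 subrr.
  by move: i {i4 i6 ik} => [|[|[|[|[|[|?]]]]]]; ring.
have -> : w = z + (w - z) by rewrite addrC subrK.
rewrite hper // => [i i6|i i4]; rewrite coordD coordN; last by rewrite wz // subrr.
case: (ltnP i 4) => i4; first by rewrite wz // subrr rpred0.
have ik : i != k by lia.
rewrite wE // ffunE inordK // (negPf ik) fk eqxx mulr0 subr0 coord_nilp //.
rewrite !yE; [|lia|lia|lia|lia].
move: k k2 i i4 i6 {k6 hk hper fk y z w wE yE wzk wz ik} => [|[|//]] _ [|[|[|[|[|[|//]]]]]] // _ _.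
all: rewrite !coord_basisv //= !(mulr0, mulr1, add0r, addr0, subr0, sub0r).
- exact: Zp_fracB.
- exact: Zp_fracB.
- by rewrite opprK; exact: Zp_frac.
- exact: Zp_fracB.
Qed.

Lemma meanD N h h' : mean N (fun x => h x + h' x) = mean N h + mean N h'.
Proof. by rewrite /mean big_split mulrDr. Qed.

Lemma meanZ N (t : R) h : mean N (fun x => t * h x) = t * mean N h.
Proof. by rewrite /mean -big_distrr /= mulrCA. Qed.

Lemma mean_cst N (t : R) : (0 < N)%N -> mean N (fun=> t) = t.
Proof.
move=> N0; rewrite /mean sumr_const card_ffun !card_ord -[t *+ _]mulr_natr natrX mulrCA.
by rewrite -exprMn mulVf ?expr1n ?mulr1 // pnatr_eq0; lia.
Qed.

Definition unit_cube : set V := [set x | forall j, 0 <= x 0 j <= 1].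

Lemma grid_cube N (f : {ffun 'I_6 -> 'I_N}) : unit_cube (grid f).
Proof.
move=> j; rewrite mxE divr_ge0 //= ler_pdivrMr ?mul1r ?ler_nat; first exact: ltnW.
by rewrite ltr0n; case: (f j) => m; case: N {f}.
Qed.

Lemma mean_bound N h (C : R) : (0 < N)%N ->
  (forall x, unit_cube x -> `|h x| <= C) -> `|mean N h| <= C.
Proof.
move=> N0 hC; rewrite -[C](mean_cst _ N0) /mean normrM ger0_norm ?exprn_ge0 ?invr_ge0 //.
rewrite ler_wpM2l ?exprn_ge0 ?invr_ge0 // (le_trans (ler_norm_sum _ _ _)) //.
by apply: ler_sum => f _; apply: hC; exact: grid_cube.
Qed.

(** [h] has zero integral over the unit cube, with a rate for the convergence of
    the Riemann sums. *)
Definition null_mean h : Prop :=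
  exists C : R, forall N, (0 < N)%N -> `|mean N h| <= C / N%:R.

Lemma null_meanD h h' : null_mean h -> null_mean h' -> null_mean (fun x => h x + h' x).
Proof.
move=> [C hC] [C' hC']; exists (C + C') => N N0; rewrite meanD mulrDl.
by apply: (le_trans (ler_normD _ _)); apply: lerD; [exact: hC|exact: hC'].
Qed.

Lemma null_meanZ (t : R) h : null_mean h -> null_mean (fun x => t * h x).
Proof.
move=> [C hC]; exists (`|t| * C) => N N0; rewrite meanZ normrM -mulrA.
by rewrite ler_wpM2l // hC.
Qed.

Lemma is_derive_line h x v (s : R) : smooth_fun h ->
  is_derive s 1 (fun t : R => h (x + t *: v)) ('D_v h (x + s *: v)).
Proof.
move=> sh; have := smooth_is_derive (x + s *: v) v sh => -[dh _].
have E : (fun r : R => r^-1 *: (h (x + (r *: 1 + s) *: v) - h (x + s *: v))) =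
         (fun r : R => r^-1 *: (h (r *: v + (x + s *: v)) - h (x + s *: v))).
  apply/funext => r; congr (_ *: (h _ - _)).
  by rewrite [r *: 1]mulr1 scalerDl addrCA.
by split; rewrite /derivable /derive /= ?E.
Qed.

Lemma mvt_line h x v (t : R) : smooth_fun h -> 0 <= t ->
  exists2 c, 0 <= c <= t & h (x + t *: v) - h x = 'D_v h (x + c *: v) * t.
Proof.
move=> sh t0.
have [|c] := @MVT_segment R (fun s => h (x + s *: v)) (fun s => 'D_v h (x + s *: v)) 0 t t0
  (fun s _ => is_derive_line x v s sh).
  apply: continuous_subspaceT => s.
  apply: differentiable_continuous; apply/derivable1_diffP.
  by case: (is_derive_line x v s sh).
rewrite in_itv /= scale0r addr0 subr0 => ct ->; by exists c.
Qed.

(** The cube of side 2 contains the points reached from the unit cube by one step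
    of the grid. *)
Lemma smooth_bounded h : smooth_fun h ->
  exists C : R, forall x, (forall j, 0 <= x 0 j <= 2) -> `|h x| <= C.
Proof.
move=> sh; pose K : set V := [set x | forall j, `[0, 2]%classic (x ord0 j)].
have cK : compact K by apply: (@rV_compact R 6 (fun=> `[0, 2]%classic)) => j; exact: segment_compact.
have K0 : K !=set0 by exists 0 => j; rewrite /= mxE in_itv /= lexx ler0n.
have [|c _ hc] := @EVT_max_rV R 6 (fun x => `|h x|) K K0 cK.
  apply: continuous_subspaceT => x; apply: (@continuous_comp _ _ _ h (fun r : R => `|r|)).
    exact: (smooth_continuous sh).
  exact: norm_continuous.
exists `|h c| => x Kx; apply: hc; rewrite inE => j /=; rewrite in_itv; exact: Kx.
Qed.

(** Two applications of the mean value theorem: the error is at most [1/N] times a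
    bound of the second derivative. *)
Lemma difference_quotient h k : (k < 6)%N -> smooth_fun h ->
  exists C : R, forall N x, (0 < N)%N -> unit_cube x ->
    `|N%:R * (h (x + N%:R^-1 *: basisv k) - h x) - 'D_(basisv k) h x| <= C / N%:R.
Proof.
move=> k6 sh; set e := basisv k.
have s2 := smooth_derive e (smooth_derive e sh).
have [C hC] := smooth_bounded s2; exists C => N x N0 x01.
have N0' : 0 < N%:R^-1 :> R by rewrite invr_gt0 ltr0n.
have N1 : N%:R^-1 <= 1 :> R by rewrite invf_le1 ?ltr0n ?ler1n.
have [c /andP[c0 cN] ->] := mvt_line x e sh (ltW N0').
rewrite mulrCA divff ?mulr1; last by rewrite pnatr_eq0 -lt0n.
have [d /andP[d0 dc] ->] := mvt_line x e (smooth_derive e sh) c0.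
rewrite normrM [`|c|]ger0_norm // ler_pM // hC // => j; rewrite 2!mxE.
have /andP[xj0 xj1] := x01 j.
have /andP[ej0 ej1] : 0 <= e 0 j <= 1.
  by rewrite /e /basisv mxE eqxx /=; case: eqP => _; rewrite ?lexx ?ler01.
apply/andP; split; first by rewrite addr_ge0 ?mulr_ge0.
rewrite -[2]/(1 + 1) lerD // -[1]mulr1 ler_pM // (le_trans dc) // (le_trans cN) //.
Qed.

(** The derivative in the direction [k] differs by [O(1/N)] from a difference
    quotient on the grid, and the latter sums to zero by [mean_shift]. *)
Lemma null_mean_derive h k : (k < 6)%N -> smooth_fun h ->
  (forall x, h (x + basisv k) = h (x - x *m nilp (basisv k))) ->
  ((k < 2)%N -> forall x a, integral_vector a ->
     (forall i, (i < 4)%N -> coord a i = 0) -> h (x + a) = h x) ->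
  null_mean (fun x => 'D_(basisv k) h x).
Proof.
move=> k6 sh hk hper; have [C hC] := difference_quotient k6 sh.
exists C => N N0; rewrite -normrN -mulN1r -meanZ.
pose q x := N%:R * (h (x + N%:R^-1 *: basisv k) + -1 * h x).
have mq : mean N q = 0 by rewrite /q meanZ meanD meanZ mean_shift // mulN1r subrr mulr0.
rewrite -[mean _ _]add0r -mq -meanD; apply: mean_bound => // x x01.
by rewrite /q !mulN1r; exact: hC.
Qed.

End RiemannSums.

(** * Functions on the compact quotient *)

Section Invariant.
Context {R : realType}.
Notation V := 'rV[R]_6.
Implicit Types (h : V -> R) (x y a : V).

Definition deck_invariant h : Prop :=
  forall a, integral_vector a -> forall x, h (ltrans a x) = h x.

Lemma nilp_eq0 (u : V) : coord u 0 = 0 -> coord u 1 = 0 -> nilp u = 0.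
Proof.
move=> u0 u1; apply/matrixP => i j; rewrite !mxE u0 u1 oppr0.
by move: (nat_of_ord i) (nat_of_ord j) => [|[|[|[|k]]]] [|[|[|[|[|[|l]]]]]].
Qed.

Lemma integral_basisv k : (k < 6)%N -> integral_vector (@basisv R k).
Proof. by move=> k6 i i6; rewrite coord_basisv // natr_int. Qed.

(** The left translation by the [k]-th basis vector is the coordinate translation up
    to a shear. *)
Lemma deck_invariant_step h k x : deck_invariant h -> (k < 6)%N ->
  h (x + basisv k) = h (x - x *m nilp (basisv k)).
Proof.
move=> hinv k6; rewrite -[RHS](hinv _ (integral_basisv k6)); congr h.
rewrite /ltrans /frame mulmxDr mulmx1 mulmxBl -mulmxA nilp_mul mulmx0 subr0.
by rewrite subrK addrC.
Qed.

(** The last two coordinates are those of the centre, where left translations are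
    coordinate translations. *)
Lemma deck_invariant_central h x a : deck_invariant h -> integral_vector a ->
  (forall i, (i < 4)%N -> coord a i = 0) -> h (x + a) = h x.
Proof.
move=> hinv ai a0; rewrite -[RHS](hinv _ ai) /ltrans /frame.
by rewrite nilp_eq0 ?a0 // addr0 mulmx1 addrC.
Qed.

Definition frame_derive (k : nat) (h : V -> R) (x : V) : R :=
  'D_(row (inord k) (frame x)) h x.

Lemma row_frame k x : (k < 6)%N -> row (inord k) (frame x) =
  basisv k + match k with
             | 2 => coord x 0 *: basisv 4 + coord x 1 *: basisv 5
             | 3 => - coord x 1 *: basisv 4 + coord x 0 *: basisv 5
             | _ => 0 end.
Proof.
move=> k6; apply: row_eq => i i6; rewrite coordD coord_basisv //.
rewrite /coord !mxE -val_eqE /= !inordK // [i == k]eq_sym.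
congr (_ + _).
move: k i k6 i6 => [|[|[|[|[|[|//]]]]]] [|[|[|[|[|[|//]]]]]] k6 i6.
all: rewrite /coord ?mxE //= -?val_eqE /= ?inordK //=; ring.
Qed.

(** The coefficient [coord x i] is constant along the direction [k], so that it
    may be put under the derivative. *)
Lemma null_mean_mul_derive h (i k : nat) : (i < 2)%N -> (4 <= k < 6)%N ->
  smooth_fun h -> deck_invariant h ->
  null_mean (fun x => coord x i * 'D_(basisv k) h x).
Proof.
move=> i2 /andP[k4 k6] sh hinv; have i6 : (i < 6)%N by lia.
have nil0 : nilp (@basisv R k) = 0.
  by apply: nilp_eq0; rewrite coord_basisv // ltn_eqF //; lia.
rewrite (_ : (fun x => _) = fun x => 'D_(basisv k) (fun y => coord y i * h y) x).
  apply: null_mean_derive => // [|x|k2].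
  - by apply: smooth_mul => //; exact: smooth_coord.
  - rewrite nil0 mulmx0 subr0 coordD coord_basisv // (ltn_eqF (leq_trans i2 _)) ?addr0; last by lia.
    by rewrite deck_invariant_step // nil0 mulmx0 subr0.
  - by lia.
apply/funext => x.
have dc : is_derive x (basisv k) (fun y : V => coord y i) (coord (basisv k) i).
  exact: is_derive_coord.
have := is_derive_mul dc (smooth_is_derive x (basisv k) sh) => H.
rewrite [RHS](@derive_val _ _ _ _ _ _ _ H) coord_basisv //.
by rewrite (ltn_eqF (leq_trans i2 _)) ?mul0r ?add0r; last by lia.
Qed.

(** Divergence theorem on the compact quotient: the left-invariant fields
    preserve Lebesgue measure. *)
Lemma null_mean_frame_derive h k : (k < 6)%N -> smooth_fun h -> deck_invariant h ->
  null_mean (frame_derive k h).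
Proof.
move=> k6 sh hinv.
have base : null_mean (fun x => 'D_(basisv k) h x).
  apply: null_mean_derive => // [x|_ x a]; first exact: deck_invariant_step.
  exact: deck_invariant_central.
have E x : frame_derive k h x = 'D_(basisv k) h x +
    match k with
    | 2 => coord x 0 * 'D_(basisv 4) h x + coord x 1 * 'D_(basisv 5) h x
    | 3 => -1 * (coord x 1 * 'D_(basisv 4) h x) + coord x 0 * 'D_(basisv 5) h x
    | _ => 0 end.
  have dD u v : 'D_(u + v) h x = 'D_u h x + 'D_v h x.
    by rewrite -[u]scale1r -[v]scale1r derive_lin // !mul1r !scale1r.
  rewrite /frame_derive row_frame // dD; congr (_ + _).
  move: k k6 {base} => [|[|[|[|[|[|//]]]]]] k6; rewrite ?derive_lin ?mulN1r ?mulNr //.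
  all: try by rewrite derive0.
rewrite (funext E); apply: (null_meanD base).
have n0 : null_mean (fun _ : V => 0 : R).
  by exists 0 => N N0; rewrite mean_cst // normr0 mul0r.
move: k k6 {base E} => [|[|[|[|[|[|//]]]]]] k6 //.
  by apply: null_meanD; apply: null_mean_mul_derive.
by apply: null_meanD; last exact: null_mean_mul_derive; apply: null_meanZ; apply: null_mean_mul_derive.
Qed.

Lemma le0_of_le_inv (t C : R) : (forall N, (0 < N)%N -> t <= C / N%:R) -> t <= 0.
Proof.
move=> tC; rewrite leNgt; apply/negP => t0.
set N := (Num.bound `|C / t|).+1; have := tC N isT.
rewrite ler_pdivlMr ?ltr0n // mulrC -ler_pdivlMr // leNgt => /negP; apply.
apply: (le_lt_trans (ler_norm _)); apply: (lt_le_trans (archi_boundP (normr_ge0 _))).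
by rewrite ler_nat.
Qed.

Lemma null_mean_cst_eq0 (t : R) : null_mean (fun _ : V => t) -> t = 0.
Proof.
move=> [C hC]; apply/eqP; rewrite -normr_le0; apply: (@le0_of_le_inv _ C) => N N0.
by have := hC N N0; rewrite mean_cst.
Qed.

Lemma sum_nat_window (N a m : nat) : (a + m <= N)%N ->
  \sum_(i < N) ((a <= i < a + m)%N)%:R = m%:R :> R.
Proof.
move=> aN; rewrite -(big_mkord xpredT (fun i => ((a <= i < a + m)%N)%:R)).
rewrite (@big_cat_nat _ _ _ a) //=; last by lia.
rewrite (@big_cat_nat _ _ _ (a + m) a) //=; last by lia.
rewrite big_nat_cond big1 ?add0r => [|i]; last by rewrite andbT => /andP[_]; rewrite ltnNge => /negPf ->.
rewrite [X in _ + X]big_nat_cond [X in _ + X]big1 ?addr0 => [|i]; last first.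
  by rewrite andbT => /andP[+ _]; rewrite leqNgt => /negPf ->; rewrite andbF.
rewrite big_nat_cond (eq_bigr (fun=> 1)) => [|i]; last by rewrite andbT => ->.
by rewrite -big_nat_cond sumr_const_nat addKn.
Qed.

(** On every refinement of the grid of step [1/M], the points of the cell alone
    contribute [e / M^6] to the mean. *)
Lemma null_mean_cell h (M : nat) (k : 'I_6 -> nat) (e : R) :
  (forall x, 0 <= h x) -> null_mean h -> (0 < M)%N -> (forall j, (k j < M)%N) ->
  (forall x, (forall j, (k j)%:R / M%:R <= x 0 j <= (k j).+1%:R / M%:R) -> e <= h x) ->
  e <= 0.
Proof.
move=> h0 [C hC] M0 kM he; have M0' : 0 < M%:R :> R by rewrite ltr0n.
suff : e * (M%:R ^-1) ^+ 6 <= 0 by rewrite pmulr_lle0 // exprn_gt0 // invr_gt0.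
apply: (@le0_of_le_inv _ (C / M%:R)) => m m0; have m0' : 0 < m%:R :> R by rewrite ltr0n.
have N0 : (0 < M * m)%N by rewrite muln_gt0 M0.
rewrite -mulrA -invfM -natrM; apply: le_trans (hC _ N0); apply: le_trans (ler_norm _).
pose w (j : 'I_6) (i : 'I_(M * m)) : R := ((k j * m <= i < k j * m + m)%N)%:R.
have sw : \sum_(f : {ffun 'I_6 -> 'I_(M * m)}) \prod_j w j (f j) = m%:R ^+ 6.
  rewrite -bigA_distr_bigA /= (eq_bigr (fun=> m%:R)) ?prodr_const ?card_ord // => j _.
  by rewrite sum_nat_window // -mulSnr leq_mul2r kM orbT.
have -> : e * M%:R^-1 ^+ 6 = (M * m)%:R^-1 ^+ 6 * (e * m%:R ^+ 6).
  by rewrite natrM; field; rewrite !gt_eqF.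
rewrite /mean ler_wpM2l ?exprn_ge0 ?invr_ge0 // -sw mulr_sumr ler_sum // => f _.
case: (boolP [forall j, (k j * m <= f j < k j * m + m)%N]) => [/forallP kf|].
  rewrite big1 ?mulr1 => [|j _]; last by rewrite /w kf.
  apply: he => j; have /andP[kf1 kf2] := kf j; rewrite mxE natrM.
  have E c : c / M%:R * (M%:R * m%:R) = c * m%:R :> R by field; rewrite gt_eqF.
  apply/andP; split.
    by rewrite ler_pdivlMr ?mulr_gt0 // E -natrM ler_nat.
  by rewrite ler_pdivrMr ?mulr_gt0 // E -natrM ler_nat mulSnr ltnW.
rewrite negb_forall => /existsP[j /negPf kf].
by rewrite (bigD1 j) //= /w kf mul0r mulr0.
Qed.

(** The lattice translates of the unit cube cover the space: the first four
    coordinates are reduced first, and they determine the shear of the last two. *)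
Lemma deck_reduce p : exists2 a : V, integral_vector a &
  forall j, 0 <= (ltrans a p) 0 j < 1.
Proof.
pose fl (x : V) : V := \row_j (- (Num.floor (x 0 j))%:~R).
have Zfl x : integral_vector (fl x).
  by move=> k k6; rewrite /coord mxE rpredN intr_int.
have flE y i : coord (fl y) i = - (Num.floor (coord y i))%:~R by rewrite /coord mxE.
pose q := p + p *m nilp (fl p); exists (fl q); first exact: Zfl.
have -> : ltrans (fl q) p = fl q + q.
  rewrite /ltrans /frame mulmxDr mulmx1; congr (_ + (_ + _ *m _)).
  by apply: nilp_eq; rewrite !flE coordD coord_nilp // addr0.
move=> j; have := floor_itv (coord q j).
by rewrite intrD coordE coordD flE => /andP[q0 q1]; apply/andP; split; lra.
Qed.

(** A point where [h] is positive may be translated into the unit cube; then [h] is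
    bounded below on a small cell containing it, against [null_mean_cell]. *)
Lemma null_mean_eq0 h : smooth_fun h -> deck_invariant h ->
  (forall x, 0 <= h x) -> null_mean h -> forall x, h x = 0.
Proof.
move=> sh hinv h0 nh x; have [a Za ap] := deck_reduce x.
rewrite -(hinv a Za x); set p := ltrans a x in ap *.
apply/eqP; rewrite eq_le h0 andbT leNgt; apply/negP => hp.
have : \forall y \near p, h p / 2 < h y.
  have hcont : {for p, continuous h} by exact: smooth_continuous.
  apply: (cvgr_gt (h p) hcont).
  by rewrite ltr_pdivrMr // mulr_natr mulr2n ltrDl.
move=> /nbhs_ballP[d d0 pd].
set M := (Num.bound d^-1).+1.
have M0 : 0 < M%:R :> R by rewrite ltr0n.
have Md : M%:R^-1 < d.
  rewrite invf_plt ?posrE //; apply: (lt_le_trans (archi_boundP _)).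
    by rewrite invr_ge0 ltW.
  by rewrite ler_nat.
pose k j := Num.truncn (p 0 j * M%:R).
have hk j : (k j)%:R <= p 0 j * M%:R < (k j).+1%:R.
  by apply: truncn_itv; have /andP[p0 _] := ap j; rewrite mulr_ge0 // ltW.
suff : h p / 2 <= 0 by rewrite leNgt divr_gt0.
apply: (@null_mean_cell h M k) => // [j|y ky].
  rewrite -(ltr_nat R); have /andP[kp _] := hk j; apply: (le_lt_trans kp).
  by rewrite gtr_pMl //; have /andP[] := ap j.
apply/ltW/pd; split=> // i j; rewrite (ord1 i) /ball /=.
apply: le_lt_trans Md; have /andP[] := ky j; have /andP[] := hk j.
rewrite -ler_pdivrMr // -ltr_pdivlMr // => k1 k2 y1 y2.
have E : (k j).+1%:R / M%:R = (k j)%:R / M%:R + M%:R^-1 :> R by rewrite -addn1 natrD mulrDl mul1r.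
by rewrite E in k2 y2; rewrite ler_norml; apply/andP; split; lra.
Qed.

End Invariant.

(** * Forms of degree one and two on the frame *)

Section Cartan.
Context {R : realType}.
Notation V := 'rV[R]_6.
Implicit Types (x y u v w : V).

Definition three_vectors u v w : 'M[R]_(3, 6) := @col_mx R 1 2 6 u (two_vectors v w).

Lemma two_vectorsE (A : 'M[R]_(2, 6)) : A = two_vectors (row 0 A) (row 1 A).
Proof.
apply/matrixP => i j; rewrite mxE; case: splitP => k; rewrite (ord1 k) => ik; rewrite mxE.
  by congr (A _ j); apply: val_inj.
by congr (A _ j); apply: val_inj.
Qed.

Lemma row0_two u v : row 0 (two_vectors u v) = u.
Proof.
apply/rowP => j; rewrite !mxE; case: splitP => k //= _; by rewrite (ord1 k).
Qed.

Lemma row1_two u v : row 1 (two_vectors u v) = v.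
Proof.
apply/rowP => j; rewrite !mxE; case: splitP => k //= ; rewrite (ord1 k) //.
Qed.

Lemma row'0_two u v : row' 0 (two_vectors u v) = v.
Proof.
apply/rowP => j; rewrite !mxE; case: splitP => k; rewrite (ord1 k) //=.
Qed.

Lemma row'1_two u v : row' 1 (two_vectors u v) = u.
Proof.
apply/rowP => j; rewrite !mxE; case: splitP => k; rewrite (ord1 k) //=.
Qed.

Lemma row0_three u v w : row 0 (three_vectors u v w) = u.
Proof.
apply/rowP => j; rewrite !mxE; case: splitP => k //= _; by rewrite (ord1 k).
Qed.

Lemma row1_three u v w : row 1 (three_vectors u v w) = v.
Proof.
apply/rowP => j; rewrite mxE /three_vectors mxE; case: splitP => k; first by rewrite (ord1 k).
case=> k0; rewrite -[in RHS](row0_two v w) [in RHS]mxE.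
by congr (fun_of_matrix (two_vectors v w) _ j); apply: val_inj.
Qed.

Lemma row2_three u v w : row (inord 2) (three_vectors u v w) = w.
Proof.
apply/rowP => j; rewrite mxE /three_vectors mxE; case: splitP => k; rewrite inordK //.
  by rewrite (ord1 k).
case=> k0; rewrite -[in RHS](row1_two v w) [in RHS]mxE.
by congr (fun_of_matrix (two_vectors v w) _ j); apply: val_inj.
Qed.

Lemma row'0_three u v w : row' 0 (three_vectors u v w) = two_vectors v w.
Proof.
apply/matrixP => i j; rewrite mxE /three_vectors mxE; case: splitP => k; first by rewrite (ord1 k).
by case=> ki; congr (fun_of_matrix (two_vectors v w) _ j); apply: val_inj.
Qed.

Lemma row'1_three u v w : row' 1 (three_vectors u v w) = two_vectors u w.
Proof.
rewrite [LHS]two_vectorsE row'Esub !row_rowsub.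
have -> : lift 1 0 = 0 :> 'I_3 by apply: val_inj.
have -> : lift 1 1 = inord 2 :> 'I_3 by apply: val_inj; rewrite /= inordK.
by rewrite row0_three row2_three.
Qed.

Lemma row'2_three u v w : row' (inord 2) (three_vectors u v w) = two_vectors u v.
Proof.
rewrite [LHS]two_vectorsE row'Esub !row_rowsub.
have -> : lift (inord 2) 0 = 0 :> 'I_3 by apply: val_inj; rewrite /= inordK.
have -> : lift (inord 2) 1 = 1 :> 'I_3 by apply: val_inj; rewrite /= inordK.
by rewrite row0_three row1_three.
Qed.

Lemma mulmx_two u v (M : 'M[R]_6) : two_vectors u v *m M = two_vectors (u *m M) (v *m M).
Proof. exact: (@mul_col_mx _ 1 1 6 6 u v M). Qed.

Lemma linear_basis (f : V -> R) :
  (forall s t u v, f (s *: u + t *: v) = s * f u + t * f v) ->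
  forall u, f u = \sum_(p < 6) u 0 p * f (delta_mx 0 p).
Proof.
move=> fl u; have f0 : f 0 = 0 by have := fl 0 0 0 0; rewrite !scale0r addr0 !mul0r addr0.
rewrite {1}[u]row_sum_delta; elim/big_rec2 : _ => [|p y z _ IH]; first exact: f0.
by rewrite -[X in f (_ + X)]scale1r fl mul1r IH.
Qed.

Section MultilinearTwo.
Variable a : 'M[R]_(2, 6) -> R.
Hypothesis ma : multilinear_alternating a.

Lemma ml2_linl v s t u u' :
  a (two_vectors (s *: u + t *: u') v) = s * a (two_vectors u v) + t * a (two_vectors u' v).
Proof. by apply: (ma.1 _ _ _ 0); rewrite ?row0_two ?row'0_two. Qed.

Lemma ml2_linr u s t v v' :
  a (two_vectors u (s *: v + t *: v')) = s * a (two_vectors u v) + t * a (two_vectors u v').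
Proof. by apply: (ma.1 _ _ _ 1); rewrite ?row1_two ?row'1_two. Qed.

Lemma ml2_diag u : a (two_vectors u u) = 0.
Proof. by apply: (ma.2 _ 0 1); rewrite ?row0_two ?row1_two. Qed.

Lemma ml2_antisym u v : a (two_vectors u v) = - a (two_vectors v u).
Proof.
have := ml2_diag (u + v).
rewrite -[u]scale1r -[v]scale1r ml2_linl !ml2_linr !ml2_diag !scale1r.
by rewrite !mul1r add0r addr0 => /eqP; rewrite addr_eq0 => /eqP.
Qed.

Lemma ml2_oppl u v : a (two_vectors (- u) v) = - a (two_vectors u v).
Proof. by have := ml2_linl v (-1) 0 u 0; rewrite scaleN1r scale0r addr0 mulN1r mul0r addr0. Qed.

Lemma ml2_oppr u v : a (two_vectors u (- v)) = - a (two_vectors u v).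
Proof. by rewrite ml2_antisym ml2_oppl -ml2_antisym. Qed.

Lemma ml2_0l v : a (two_vectors 0 v) = 0.
Proof. by have := ml2_linl v 0 0 0 0; rewrite !scale0r addr0 !mul0r addr0. Qed.

Lemma ml2_0r u : a (two_vectors u 0) = 0.
Proof. by rewrite ml2_antisym ml2_0l oppr0. Qed.

Lemma ml2_expand u v : a (two_vectors u v) =
  \sum_(p < 6) \sum_(q < 6)
    u 0 p * (v 0 q * a (two_vectors (delta_mx 0 p) (delta_mx 0 q))).
Proof.
rewrite (@linear_basis (fun u => a (two_vectors u v))); last first.
  by move=> s t u1 u2; rewrite ml2_linl.
apply: eq_bigr => p _; rewrite (@linear_basis (fun v => a (two_vectors _ v))).
  by rewrite mulr_sumr.
by move=> s t u1 u2; rewrite ml2_linr.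
Qed.

End MultilinearTwo.

Lemma ml1_lin (a : 'M[R]_(1, 6) -> R) s t u v : multilinear_alternating a ->
  a (s *: u + t *: v) = s * a u + t * a v.
Proof.
move=> [ma _]; apply: (ma _ _ _ 0).
- by apply/rowP => j; rewrite !mxE.
- by apply/matrixP => -[].
- by apply/matrixP => -[].
Qed.

Lemma ext_d_1form (c : @kform R 5 1) x u v : ext_d c x (two_vectors u v) =
  'D_u (fun y => c y v) x - 'D_v (fun y => c y u) x.
Proof.
rewrite /ext_d !big_ord_recl big_ord0 addr0 expr0 mul1r row0_two row'0_two.
rewrite (_ : lift ord0 ord0 = 1); last exact: val_inj.
by rewrite row1_two row'1_two /bump /= expr1 mulN1r.
Qed.

Lemma ext_d_2form (b : @kform R 5 2) x u v w : ext_d b x (three_vectors u v w) =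
  'D_u (fun y => b y (two_vectors v w)) x - 'D_v (fun y => b y (two_vectors u w)) x
  + 'D_w (fun y => b y (two_vectors u v)) x.
Proof.
rewrite /ext_d !big_ord_recl big_ord0 addr0 expr0 mul1r row0_three row'0_three.
have -> : lift ord0 (lift ord0 ord0) = inord 2 :> 'I_3.
  by apply: val_inj; rewrite /= inordK.
have -> : lift ord0 ord0 = 1 :> 'I_3 by exact: val_inj.
rewrite row1_three row'1_three row2_three row'2_three inordK // /bump /= expr1 mulN1r.
by rewrite addrA sqrrN expr1n mul1r.
Qed.

Lemma is_derive_affine (W : normedModType R) (f : V -> W) x w (d : W) :
  (forall t, f (t *: w + x) = f x + t *: d) -> is_derive x w f d.
Proof.
move=> fd; have cv : (fun r => r^-1 *: (f (r *: w + x) - f x)) @ 0^' --> d.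
  apply: (@cvg_trans _ (cst d @ 0^')); last exact: cvg_cst.
  apply: near_eq_cvg; near=> r; rewrite fd addrAC subrr add0r.
  rewrite /cst [RHS]scalerA mulVf ?scale1r //; near: r; exact: nbhs_dnbhs_neq.
split; first by apply/cvg_ex; exists d.
exact: cvg_lim cv.
Unshelve. all: by end_near. Qed.

Lemma is_derive_nilp (m m0 x w : V) (j : 'I_6) :
  is_derive x w (fun y => (m0 + m *m nilp y) 0 j) ((m *m nilp w) 0 j).
Proof.
apply: is_derive_affine => t.
by rewrite nilpD nilpZ mulmxDr -scalemxAr !mxE /GRing.scale /=; ring.
Qed.

End Cartan.

Section MovingFrame.
Context {R : realType}.
Notation V := 'rV[R]_6.
Implicit Types (x y u v w : V).

Definition frame_vec (i : nat) (x : V) : V := row (inord i) (frame x).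

Lemma frame_vecE i x : frame_vec i x = basisv i + basisv i *m nilp x.
Proof. by rewrite /frame_vec rowE /frame mulmxDr mulmx1. Qed.

(** [connection i j] is the constant derivative of the frame field [E_j] along [E_i]. *)
Definition connection (i j : nat) : V := basisv j *m nilp (basisv i).

Lemma connectionE i j x : (i < 6)%N -> (j < 6)%N -> connection i j =
  match i, j with
  | 0, 2 => frame_vec 4 x | 0, 3 => frame_vec 5 x
  | 1, 2 => frame_vec 5 x | 1, 3 => - frame_vec 4 x
  | _, _ => 0
  end.
Proof.
move=> i6 j6; apply: row_eq => k k6; rewrite /connection coord_nilp // !coord_basisv //.
have fr4 l : (4 <= l < 6)%N -> frame_vec l x = basisv l.
  move=> l6; rewrite frame_vecE; apply: row_eq => m m6; rewrite coordD coord_nilp // !coord_basisv //; try lia.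
  by move: l l6 m m6 => [|[|[|[|[|[|//]]]]]] // _ [|[|[|[|[|[|//]]]]]] // _ /=; ring.
rewrite !fr4 //.
have c0 : coord (0 : V) k = 0 by rewrite /coord mxE.
move: i i6 j j6 => [|[|[|[|[|[|//]]]]]] // _ [|[|[|[|[|[|//]]]]]] // _.
all: rewrite ?coordN ?c0 ?coord_basisv //; move: k k6 {c0} => [|[|[|[|[|[|//]]]]]] // _ /=; ring.
Qed.

Lemma nilp_frame_vec i x : nilp (frame_vec i x) = nilp (basisv i).
Proof. by rewrite frame_vecE nilpD nilp_nilp addr0. Qed.

Lemma smooth_nilp (i j : 'I_6) : smooth_fun (fun y : V => nilp y i j).
Proof.
rewrite (_ : (fun y => _) = fun y =>
   match nat_of_ord i, nat_of_ord j with
   | 2, 4 => coord y 0 | 2, 5 => coord y 1 | 3, 4 => - coord y 1 | 3, 5 => coord y 0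
   | _, _ => 0 end); last by apply/funext => y; rewrite mxE.
have s0 : smooth_fun (fun _ : V => 0 : R) by exact: smooth_cst.
have sc k : smooth_fun (fun y : V => coord y k) by exact: smooth_coord.
have sN k : smooth_fun (fun y : V => - coord y k) by apply: smooth_opp; exact: sc.
by move: (nat_of_ord i) (nat_of_ord j) => [|[|[|[|k]]]] [|[|[|[|[|[|l]]]]]].
Qed.

Lemma smooth_frame_vec j (p : 'I_6) : smooth_fun (fun y => frame_vec j y 0 p).
Proof.
rewrite (_ : (fun y => _) = fun y => (1%:M : 'M[R]_6) (inord j) p + nilp y (inord j) p).
  by apply: smooth_add; [exact: smooth_cst|exact: smooth_nilp].
by apply/funext => y; rewrite !mxE.
Qed.

Definition comp1 (c : @kform R 5 1) (i : nat) (x : V) : R := c x (frame_vec i x).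

Definition comp2 (a : @kform R 5 2) (i j : nat) (x : V) : R :=
  a x (two_vectors (frame_vec i x) (frame_vec j x)).

Section OneForm.
Variable c : @kform R 5 1.
Hypothesis mc : forall x, multilinear_alternating (c x).
Hypothesis sc : forall A, smooth_fun (fun x => c x A).

Lemma oneform_expand y u : c y u = \sum_(p < 6) u 0 p * c y (delta_mx 0 p).
Proof. by apply: (@linear_basis R (c y)) => s t u1 u2; exact: ml1_lin. Qed.

Lemma derive_oneform_expand x w u :
  'D_w (fun y => c y u) x = \sum_(p < 6) u 0 p * 'D_w (fun y => c y (delta_mx 0 p)) x.
Proof.
have H : is_derive x w (fun y => \sum_(p < 6) u 0 p * c y (delta_mx 0 p))
   (\sum_(p < 6) (0 * c x (delta_mx 0 p) + u 0 p * 'D_w (fun y => c y (delta_mx 0 p)) x)).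
  apply: is_derive_bigsum => p.
  apply: (@is_derive_mul R 5 (fun=> u 0 p)).
  exact: smooth_is_derive.
rewrite (_ : (fun y => c y u) = fun y => \sum_(p < 6) u 0 p * c y (delta_mx 0 p)).
  by rewrite (@derive_val _ _ _ _ _ _ _ H); apply: eq_bigr => p _; rewrite mul0r add0r.
by apply/funext => y; exact: oneform_expand.
Qed.

(** Leibniz rule for a form evaluated on a field affine in the base point, as the
    frame fields are. *)
Lemma derive_moving1 m0 m x w :
  'D_w (fun y => c y (m0 + m *m nilp y)) x =
  'D_w (fun y => c y (m0 + m *m nilp x)) x + c x (m *m nilp w).
Proof.
pose M y := m0 + m *m nilp y.
have H : is_derive x w (fun y => \sum_(p < 6) M y 0 p * c y (delta_mx 0 p))
   (\sum_(p < 6) ((m *m nilp w) 0 p * c x (delta_mx 0 p)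
                 + M x 0 p * 'D_w (fun y => c y (delta_mx 0 p)) x)).
  apply: is_derive_bigsum => p; apply: is_derive_mul; first exact: is_derive_nilp.
  exact: smooth_is_derive.
rewrite (_ : (fun y => c y (m0 + m *m nilp y)) = fun y => \sum_(p < 6) M y 0 p * c y (delta_mx 0 p)).
  by rewrite (@derive_val _ _ _ _ _ _ _ H) big_split /= -oneform_expand -derive_oneform_expand addrC.
by apply/funext => y; exact: oneform_expand.
Qed.

Lemma frame_derive_comp1 i j x :
  'D_(frame_vec i x) (fun y => c y (frame_vec j x)) x = frame_derive i (comp1 c j) x - c x (connection i j).
Proof.
rewrite /frame_derive -/(frame_vec i x) /comp1.
rewrite (_ : (fun x0 => c x0 (frame_vec j x0)) = fun y => c y (basisv j + basisv j *m nilp y)).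
  by rewrite derive_moving1 nilp_frame_vec -frame_vecE addrK.
by apply/funext => y; rewrite frame_vecE.
Qed.

Lemma cartan1 i j x : ext_d c x (two_vectors (frame_vec i x) (frame_vec j x)) =
  frame_derive i (comp1 c j) x - frame_derive j (comp1 c i) x
  - (c x (connection i j) - c x (connection j i)).
Proof. by rewrite ext_d_1form !frame_derive_comp1; ring. Qed.

Lemma smooth_comp1 j : smooth_fun (comp1 c j).
Proof.
rewrite /comp1 (_ : (fun x => _) = fun y => \sum_(p < 6) frame_vec j y 0 p * c y (delta_mx 0 p)).
  apply: smooth_sum => p; apply: smooth_mul => //.
  exact: smooth_frame_vec.
by apply/funext => y; exact: oneform_expand.
Qed.

End OneForm.

Section TwoForm.
Variable a : @kform R 5 2.
Hypothesis ma : forall x, multilinear_alternating (a x).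
Hypothesis sa : forall A, smooth_fun (fun x => a x A).

Let e (p q : 'I_6) : 'M[R]_(2, 6) := two_vectors (delta_mx 0 p) (delta_mx 0 q).

Lemma is_derive_two (M N : V -> V) (x w dM dN : V) :
  (forall p, is_derive x w (fun y => M y 0 p) (dM 0 p)) ->
  (forall p, is_derive x w (fun y => N y 0 p) (dN 0 p)) ->
  is_derive x w (fun y => a y (two_vectors (M y) (N y)))
    (\sum_(p < 6) \sum_(q < 6) M x 0 p * (N x 0 q * 'D_w (fun y => a y (e p q)) x)
     + a x (two_vectors dM (N x)) + a x (two_vectors (M x) dN)).
Proof.
move=> HM HN.
rewrite [X in is_derive _ _ X _](_ : _ = fun y =>
  \sum_(p < 6) \sum_(q < 6) M y 0 p * (N y 0 q * a y (e p q))); last first.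
  by apply/funext => y; exact: ml2_expand.
rewrite !(ml2_expand (ma x)) -!big_split /=; apply: is_derive_bigsum => p.
rewrite -!big_split /=; apply: is_derive_bigsum => q.
have H := is_derive_mul (HM p) (is_derive_mul (HN q) (smooth_is_derive x w (sa (e p q)))).
by apply: is_derive_eq H _; rewrite /e; ring.
Qed.

Lemma derive_moving2 (m0 m n0 n x w : V) :
  'D_w (fun y => a y (two_vectors (m0 + m *m nilp y) (n0 + n *m nilp y))) x =
  'D_w (fun y => a y (two_vectors (m0 + m *m nilp x) (n0 + n *m nilp x))) x
  + a x (two_vectors (m *m nilp w) (n0 + n *m nilp x))
  + a x (two_vectors (m0 + m *m nilp x) (n *m nilp w)).
Proof.
have H := is_derive_two (fun p => is_derive_nilp m m0 x w p) (fun p => is_derive_nilp n n0 x w p).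
rewrite (@derive_val _ _ _ _ _ _ _ H); congr (_ + _ + _).
have cst0 (u : V) p : is_derive x w (fun _ : V => u 0 p) ((0 : V) 0 p).
  by rewrite mxE; exact: is_derive_cst.
have H' := is_derive_two (cst0 (m0 + m *m nilp x)) (cst0 (n0 + n *m nilp x)).
by rewrite (@derive_val _ _ _ _ _ _ _ H') (ml2_0l (ma x)) (ml2_0r (ma x)) !addr0.
Qed.

Lemma frame_derive_comp2 i j k x :
  'D_(frame_vec i x) (fun y => a y (two_vectors (frame_vec j x) (frame_vec k x))) x =
  frame_derive i (comp2 a j k) x
  - a x (two_vectors (connection i j) (frame_vec k x)) - a x (two_vectors (frame_vec j x) (connection i k)).
Proof.
rewrite /frame_derive -/(frame_vec i x) /comp2.
rewrite [X in _ = 'D_ _ X x - _ - _](_ : _ = fun y => a y (two_vectors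
   (basisv j + basisv j *m nilp y) (basisv k + basisv k *m nilp y))).
  by rewrite derive_moving2 nilp_frame_vec -!frame_vecE /connection; ring.
by apply/funext => y; rewrite !frame_vecE.
Qed.

(** Cartan's formula for [d a] on three frame fields, whose brackets are
    [[E_i, E_j] = connection i j - connection j i]. *)
Lemma cartan2 i j k x : ext_d a x (three_vectors (frame_vec i x) (frame_vec j x) (frame_vec k x)) =
  frame_derive i (comp2 a j k) x - frame_derive j (comp2 a i k) x
  + frame_derive k (comp2 a i j) x
  - a x (two_vectors (connection i j) (frame_vec k x)) - a x (two_vectors (frame_vec j x) (connection i k))
  + a x (two_vectors (connection j i) (frame_vec k x)) + a x (two_vectors (frame_vec i x) (connection j k))
  - a x (two_vectors (connection k i) (frame_vec j x)) - a x (two_vectors (frame_vec i x) (connection k j)).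
Proof. by rewrite ext_d_2form !frame_derive_comp2; ring. Qed.

Lemma smooth_comp2 i j : smooth_fun (comp2 a i j).
Proof.
rewrite /comp2 (_ : (fun x => _) = fun y =>
  \sum_(p < 6) \sum_(q < 6) frame_vec i y 0 p * (frame_vec j y 0 q * a y (e p q))).
  apply: smooth_sum => p; apply: smooth_sum => q.
  by apply: smooth_mul; [|apply: smooth_mul => //]; exact: smooth_frame_vec.
by apply/funext => y; exact: ml2_expand.
Qed.

Lemma comp2_antisym i j x : comp2 a i j x = - comp2 a j i x.
Proof. exact: ml2_antisym. Qed.

Lemma comp2_diag i x : comp2 a i i x = 0.
Proof. exact: ml2_diag. Qed.

(** The frame is a basis at every point. *)
Lemma comp2_eq0 x : (forall i j, (i < j < 6)%N -> comp2 a i j x = 0) -> a x = 0.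
Proof.
move=> a0; apply/funext => A; rewrite [A]two_vectorsE.
have c0 (i j : 'I_6) : comp2 a i j x = 0.
  case: (ltngtP i j) => ij; first by apply: a0; rewrite ij ltn_ord.
    by rewrite comp2_antisym a0 ?oppr0 // ij ltn_ord.
  by rewrite ij comp2_diag.
rewrite -[row 0 A]mulmx1 -[row 1 A]mulmx1 -(coframeK x) !mulmxA.
move: (row 0 A *m _) (row 1 A *m _) => u v; rewrite -mulmx_two.
have mf : multilinear_alternating (fun B => a x (B *m frame x)).
  split=> [B C D i s t rB rC rD|B i j ij rij].
    apply: ((ma x).1 _ _ _ i).
    - by rewrite !row_mul rB mulmxDl -!scalemxAl.
    - by rewrite !row'Esub -!mul_rowsub_mx -!row'Esub rC.
    - by rewrite !row'Esub -!mul_rowsub_mx -!row'Esub rD.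
  by apply: ((ma x).2 _ i j) => //; rewrite !row_mul rij.
rewrite (ml2_expand mf) big1 // => p _; rewrite big1 // => q _.
rewrite mulmx_two -!rowE.
by have := c0 p q; rewrite /comp2 /frame_vec !inord_val => ->; rewrite !mulr0.
Qed.

End TwoForm.

Lemma diff_ltrans (t x v : V) : 'd (ltrans t) x v = v *m frame t.
Proof.
have df : differentiable (ltrans t) x.
  rewrite (_ : ltrans t = cst t + \sum_(p < 6) (fun y : V => y 0 p *: row p (frame t))).
    apply: differentiableD; first exact: differentiable_cst.
    apply: differentiable_sum => p; apply: differentiableZl; exact: differentiable_coord.
  by apply/funext => y; rewrite /ltrans mulmx_sum_row fct_sumE.
rewrite -deriveE //.
have H : is_derive x v (ltrans t) (v *m frame t).
  apply: is_derive_affine => s.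
  by rewrite /ltrans mulmxDl -scalemxAl addrCA addrC.
exact: derive_val.
Qed.

Lemma pullback_ltrans (k : nat) (b : @kform R 5 k) t x A :
  pullback (ltrans t) b x A = b (ltrans t x) (A *m frame t).
Proof.
rewrite /pullback; congr (b _ _); apply/row_matrixP => i.
by rewrite rowK diff_ltrans row_mul.
Qed.

Lemma frame_vec_ltrans t i x : frame_vec i (ltrans t x) = frame_vec i x *m frame t.
Proof. by rewrite /frame_vec -frame_ltrans row_mul. Qed.

Lemma deck_pullback (k : nat) (b : @kform R 5 k) t : kforms iwasawa_deck b ->
  integral_vector t -> forall x A, b (ltrans t x) (A *m frame t) = b x A.
Proof.
move=> [_ [_ hb]] Zt x A; rewrite -pullback_ltrans hb //.
by apply/iwasawa_deckP; exists t.
Qed.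

Lemma deck_invariant_comp1 (c : @kform R 5 1) i :
  kforms iwasawa_deck c -> deck_invariant (comp1 c i).
Proof. by move=> kc t Zt x; rewrite /comp1 frame_vec_ltrans deck_pullback. Qed.

Lemma deck_invariant_comp2 (b : @kform R 5 2) i j :
  kforms iwasawa_deck b -> deck_invariant (comp2 b i j).
Proof. by move=> kb t Zt x; rewrite /comp2 !frame_vec_ltrans -mulmx_two deck_pullback. Qed.

End MovingFrame.

(** * Types of real two-forms *)

Section Types.
Context {R : realType}.
Notation V := 'rV[R]_6.
Implicit Types (x y u v w : V).

Notation toC := (map_mx (fun r : R => r%:C%C)).

Definition cvec (u u' : V) : 'rV[R[i]]_6 := toC u + ('i)%C *: toC u'.

Definition cmat (u u' v v' : V) : 'M[R[i]]_(2, 6) := @col_mx _ 1 1 6 (cvec u u') (cvec v v').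

Lemma cmat_row0 u u' v v' : row 0 (cmat u u' v v') = cvec u u'.
Proof.
by apply/rowP => j; rewrite mxE /cmat mxE; case: splitP => k //; rewrite (ord1 k).
Qed.

Lemma cmat_row1 u u' v v' : row 1 (cmat u u' v v') = cvec v v'.
Proof.
by apply/rowP => j; rewrite mxE /cmat mxE; case: splitP => k; rewrite (ord1 k).
Qed.

Lemma sum_set2 (F : {set 'I_2} -> R[i]) :
  \sum_S F S = F finset.set0 + F [set 0]%SET + F [set 1]%SET + F [set: 'I_2]%SET.
Proof.
have mem2 (S T : {set 'I_2}) : (0 \in S) = (0 \in T) -> (1 \in S) = (1 \in T) -> S = T.
  move=> e0 e1; apply/setP => i; have [->//|->//] : i = 0 \/ i = 1.
  by case: i => -[|[|//]] ?; [left|right]; apply: val_inj.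
have ne (S T : {set 'I_2}) i : (i \in S) != (i \in T) -> S != T.
  by apply: contraNneq => ->.
rewrite (bigD1 finset.set0) //= (bigD1 [set 0]%SET) /=; last by apply: (ne _ _ 0); rewrite !inE.
rewrite (bigD1 [set 1]%SET) /=; last first.
  by rewrite (ne _ _ 1) ?(ne _ [set 0]%SET 1) ?inE.
rewrite (bigD1 [set: 'I_2]%SET) /=; last first.
  by rewrite (ne _ finset.set0 0) ?(ne _ [set 0]%SET 1) ?(ne _ [set 1]%SET 0) ?inE.
rewrite big1 ?addr0 ?addrA // => S /andP[/andP[/andP[S0 S1] S2] S3].
exfalso; case: (boolP (0 \in S)) => m0; case: (boolP (1 \in S)) => m1.
- by case/eqP: S3; apply: mem2; rewrite ?inE ?m0 ?m1.
- by case/eqP: S1; apply: mem2; rewrite !inE ?m0 ?(negPf m1).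
- by case/eqP: S2; apply: mem2; rewrite !inE ?m1 ?(negPf m0).
- by case/eqP: S0; apply: mem2; rewrite !inE ?(negPf m1) ?(negPf m0).
Qed.

Lemma complexify_cmat (a : @kform R 5 2) x u u' v v' :
  complexify a x (cmat u u' v v') =
  ((a x (two_vectors u v) - a x (two_vectors u' v'))
   +i* (a x (two_vectors u' v) + a x (two_vectors u v')))%C.
Proof.
have mE (S : {set 'I_2}) : (\matrix_(i, j) if i \in S then complex.Im (cmat u u' v v' i j)
      else complex.Re (cmat u u' v v' i j)) =
   two_vectors (if 0 \in S then u' else u) (if 1 \in S then v' else v).
  have reE w w' j : complex.Re (cvec w w' 0 j) = w 0 j.
    by rewrite !mxE /=; ring.
  have imE w w' j : complex.Im (cvec w w' 0 j) = w' 0 j.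
    by rewrite !mxE /=; ring.
  rewrite [LHS]two_vectorsE; congr two_vectors; apply/rowP => j; rewrite 2!mxE.
    have -> : cmat u u' v v' 0 j = cvec u u' 0 j by rewrite -(cmat_row0 u u' v v') [RHS]mxE.
    by rewrite reE imE; case: ifP.
  have -> : cmat u u' v v' 1 j = cvec v v' 0 j by rewrite -(cmat_row1 u u' v v') [RHS]mxE.
  by rewrite reE imE; case: ifP.
rewrite /complexify sum_set2 !mE !inE /= cards0 !cards1 cardsT card_ord.
by apply/eqP; rewrite eq_complex /=; apply/andP; split; apply/eqP; ring.
Qed.

Lemma ceval_Re (eta : cform 2) x u u' v v' :
  complex.Re (ceval eta x (cmat u u' v v')) =
  eta.1 x (two_vectors u v) - eta.1 x (two_vectors u' v')
  - (eta.2 x (two_vectors u' v) + eta.2 x (two_vectors u v')).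
Proof. by rewrite /ceval !complexify_cmat /=; ring. Qed.

Section WithJ.
Variable J : V -> 'M[R]_6.
Hypothesis JJ : forall x, J x *m J x = - 1%:M.

Lemma cvecM u u' (M : 'M[R]_6) : cvec u u' *m toC M = cvec (u *m M) (u' *m M).
Proof. by rewrite /cvec mulmxDl -scalemxAl -!(map_mxM (@real_complex R)). Qed.

Lemma T10_cvec x u : T10 J x (cvec u (- (u *m J x))).
Proof.
rewrite /T10 cvecM mulNmx -mulmxA JJ mulmxN mulmx1 opprK /cvec.
by apply/rowP => j; rewrite !mxE; apply/eqP; rewrite eq_complex /=; apply/andP; split; apply/eqP; ring.
Qed.

Lemma T01_cvec x u : T01 J x (cvec u (u *m J x)).
Proof.
rewrite /T01 cvecM -mulmxA JJ mulmxN mulmx1 /cvec.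
by apply/rowP => j; rewrite !mxE; apply/eqP; rewrite eq_complex /=; apply/andP; split; apply/eqP; ring.
Qed.

(** The vectors [u - i J u] and [v - i J v] are both of type (1,0), so [a] vanishes
    on them; this is the real part. *)
Lemma forms11_inv G (a : @kform R 5 2) x u v :
  multilinear_alternating (a x) -> @forms_pq R 5 G J 1 1 (realform a) ->
  a x (two_vectors (u *m J x) (v *m J x)) = a x (two_vectors u v).
Proof.
move=> ma [_ ha].
have := ha x (cmat u (- (u *m J x)) v (- (v *m J x))) [set: 'I_2]%SET.
rewrite cardsT card_ord => H.
have {}H := congr1 (@complex.Re R) (H _ isT).
rewrite ceval_Re /= !addr0 ml2_oppl // ml2_oppr // opprK in H.
apply/esym/eqP; rewrite -subr_eq0; apply/eqP; rewrite -[RHS]H ?subr0 // => i; rewrite inE.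
have [->|->] : i = 0 \/ i = 1 by case: i => -[|[|//]] ?; [left|right]; apply: val_inj.
  by rewrite cmat_row0; exact: T10_cvec.
by rewrite cmat_row1; exact: T10_cvec.
Qed.

(** The vector [u - i J u] has type (1,0) and [v + i J v] has type (0,1); this is
    the real part of the vanishing of [a] on them. *)
Lemma forms20_02_antiinv G (a : @kform R 5 2) x u v :
  multilinear_alternating (a x) ->
  (exists eta theta : cform 2, [/\ @forms_pq R 5 G J 2 0 eta, @forms_pq R 5 G J 0 2 theta &
              realform a = (eta.1 + theta.1, eta.2 + theta.2)]) ->
  a x (two_vectors (u *m J x) (v *m J x)) = - a x (two_vectors u v).
Proof.
move=> ma [eta [theta [[_ he] [_ ht] [ea e2]]]].
pose A := cmat u (- (u *m J x)) v (v *m J x).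
have TA i : if i \in [set 0]%SET then T10 J x (row i A) else T01 J x (row i A).
  have [->|->] : i = 0 \/ i = 1 by case: i => -[|[|//]] ?; [left|right]; apply: val_inj.
    by rewrite inE cmat_row0; exact: T10_cvec.
  by rewrite inE cmat_row1; exact: T01_cvec.
have c1 : #|[set 0 : 'I_2]%SET| = 1%N by rewrite cards1.
have := congr1 (@complex.Re R) (he x A [set 0]%SET TA _); rewrite c1 => /(_ isT).
have := congr1 (@complex.Re R) (ht x A [set 0]%SET TA _); rewrite c1 => /(_ isT).
rewrite !ceval_Re /=.
have D B : (eta.1 + theta.1) x B = eta.1 x B + theta.1 x B by [].
have D2 B : eta.2 x B + theta.2 x B = 0.
  exact: (esym (congr1 (fun f : kform 2 => f x B) e2)).
have := ml2_oppl ma (u *m J x) (v *m J x); rewrite ea !D.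
have := D2 (two_vectors (- (u *m J x)) v); have := D2 (two_vectors u (v *m J x)).
move=> H1 H2 H3 H4 H5. lra.
Qed.
End WithJ.
End Types.

(** * Purity and failure of fullness *)

Ltac abstract_components :=
  clear; repeat match goal with
  | |- context [frame_derive ?k ?f ?x] => generalize (frame_derive k f x); intro
  | |- context [comp2 ?b ?i ?j ?x] => generalize (comp2 b i j x); intro
  | |- context [comp1 ?c ?i ?x] => generalize (comp1 c i x); intro
  end.
Ltac linear_in_components := abstract_components; lra.
Ltac ring_in_components := abstract_components; ring.

Section PureNotFull.
Context {R : realType}.
Notation V := 'rV[R]_6.
Implicit Types (x y u v w : V).

(** The almost-complex structure in the frame. *)
Definition Jstd : 'M[R]_6 :=
  \matrix_(i, j) match nat_of_ord i, nat_of_ord j with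
                 | 0, 5 | 1, 4 | 2, 3 => 1
                 | 3, 2 | 4, 1 | 5, 0 => -1
                 | _, _ => 0
                 end.

Definition Jmat x : 'M[R]_6 := coframe x *m Jstd *m frame x.

Lemma Jstd_sqr : Jstd *m Jstd = - 1%:M.
Proof.
apply/matrixP => i j; rewrite !mxE sum6 !mxE !inordK //.
case: i => -[|[|[|[|[|[|//]]]]]] // i6; case: j => -[|[|[|[|[|[|//]]]]]] // j6.
all: rewrite -?val_eqE /=; ring.
Qed.

Lemma Jmat_sqr x : Jmat x *m Jmat x = - 1%:M.
Proof.
rewrite /Jmat -!mulmxA (mulmxA (frame x)) frameK mul1mx (mulmxA Jstd) Jstd_sqr.
by rewrite mulNmx mul1mx mulmxN coframeK.
Qed.

Lemma row_Jstd i : (i < 6)%N -> row (inord i) Jstd =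
  match i with
  | 0 => basisv 5 | 1 => basisv 4 | 2 => basisv 3
  | 3 => - basisv 2 | 4 => - basisv 1 | _ => - basisv 0 end.
Proof.
move: i => [|[|[|[|[|[|//]]]]]] _.
all: apply: row_eq => k k6; rewrite ?coordN coord_basisv // /coord !mxE !inordK //.
all: by move: k k6 => [|[|[|[|[|[|//]]]]]] _ /=; ring.
Qed.

Lemma frame_vecJ i x : (i < 6)%N -> frame_vec i x *m Jmat x =
  match i with
  | 0 => frame_vec 5 x | 1 => frame_vec 4 x | 2 => frame_vec 3 x
  | 3 => - frame_vec 2 x | 4 => - frame_vec 1 x | _ => - frame_vec 0 x
  end.
Proof.
move=> i6; rewrite /Jmat /frame_vec !rowE !mulmxA -[_ *m frame x *m coframe x]mulmxA frameK mulmx1.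
rewrite -!mulNmx.
rewrite -(rowE _ Jstd) row_Jstd //.
by move: i i6 => [|[|[|[|[|[|//]]]]]].
Qed.

Lemma frame_deriveZ k (s : R) (f : V -> R) x : smooth_fun f ->
  frame_derive k (fun y => s * f y) x = s * frame_derive k f x.
Proof.
move=> sf; rewrite /frame_derive.
have H := is_derive_mul (@is_derive_cst R _ _ s x (row (inord k) (frame x)))
  (smooth_is_derive x (row (inord k) (frame x)) sf).
by rewrite (@derive_val _ _ _ _ _ _ _ H) mul0r add0r.
Qed.

Lemma frame_derive_cst k (s : R) x : frame_derive k (fun=> s) x = 0.
Proof. exact: derive_cst. Qed.

Lemma frame_deriveM k (f g : V -> R) x : smooth_fun f -> smooth_fun g ->
  frame_derive k (fun y => f y * g y) x =
  frame_derive k f x * g x + f x * frame_derive k g x.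
Proof.
move=> sf sg; rewrite /frame_derive; set v := row _ _.
have H := is_derive_mul (smooth_is_derive x v sf) (smooth_is_derive x v sg).
exact: (@derive_val _ _ _ _ _ _ _ H).
Qed.

Lemma frame_derive_sum k (I : Type) (r : seq I) (f : I -> V -> R) x :
  (forall i, smooth_fun (f i)) ->
  frame_derive k (fun y => \sum_(i <- r) f i y) x = \sum_(i <- r) frame_derive k (f i) x.
Proof.
move=> sf; rewrite /frame_derive; set v := row _ _.
have H := is_derive_bigsum r (fun i => smooth_is_derive x v (sf i)).
exact: (@derive_val _ _ _ _ _ _ _ H).
Qed.

Section Relations.
Variable (b : @kform R 5 2) (s : R).
Hypothesis mb : forall x, multilinear_alternating (b x).
Hypothesis hb : forall x u v,
  b x (two_vectors (u *m Jmat x) (v *m Jmat x)) = s * b x (two_vectors u v).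

(** Nine relations from the pairs of frame vectors; [s] is 1 for type (1,1) and -1
    for type (2,0)+(0,2). *)
Lemma comp2_J x :
  [/\ [/\ comp2 b 4 5 x = - s * comp2 b 0 1 x, comp2 b 1 5 x = s * comp2 b 0 4 x
      & comp2 b 3 5 x = - s * comp2 b 0 2 x],
      [/\ comp2 b 2 5 x = s * comp2 b 0 3 x, comp2 b 3 4 x = - s * comp2 b 1 2 x
      & comp2 b 2 4 x = s * comp2 b 1 3 x] &
      [/\ comp2 b 0 5 x = s * comp2 b 0 5 x, comp2 b 1 4 x = s * comp2 b 1 4 x
      & comp2 b 2 3 x = s * comp2 b 2 3 x]].
Proof.
have H i j := hb x (frame_vec i x) (frame_vec j x).
have an i j : b x (two_vectors (frame_vec i x) (frame_vec j x)) = - b x (two_vectors (frame_vec j x) (frame_vec i x)).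
  exact: ml2_antisym.
rewrite /comp2; split; split.
- by have := H 0%N 1%N; rewrite !frame_vecJ // an; lra.
- by have := H 0%N 4%N; rewrite !frame_vecJ // ml2_oppr // an; lra.
- by have := H 0%N 2%N; rewrite !frame_vecJ // an; lra.
- by have := H 0%N 3%N; rewrite !frame_vecJ // ml2_oppr // an; lra.
- by have := H 1%N 2%N; rewrite !frame_vecJ // an; lra.
- by have := H 1%N 3%N; rewrite !frame_vecJ // ml2_oppr // an; lra.
- by have := H 0%N 5%N; rewrite !frame_vecJ // ml2_oppr // an; lra.
- by have := H 1%N 4%N; rewrite !frame_vecJ // ml2_oppr // an; lra.
- by have := H 2%N 3%N; rewrite !frame_vecJ // ml2_oppr // an; lra.
Qed.

End Relations.
Lemma closed_comp2 (a : @kform R 5 2) i j k x :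
  (forall x, multilinear_alternating (a x)) ->
  (forall A, smooth_fun (fun x => a x A)) -> ext_d a = 0 ->
  frame_derive i (comp2 a j k) x - frame_derive j (comp2 a i k) x
  + frame_derive k (comp2 a i j) x
  - a x (two_vectors (connection i j) (frame_vec k x)) - a x (two_vectors (frame_vec j x) (connection i k))
  + a x (two_vectors (connection j i) (frame_vec k x)) + a x (two_vectors (frame_vec i x) (connection j k))
  - a x (two_vectors (connection k i) (frame_vec j x)) - a x (two_vectors (frame_vec i x) (connection k j)) = 0.
Proof. by move=> ma sa da; rewrite -cartan2 // da. Qed.

(** An anti-invariant closed form [b] is coclosed: summing [d b = 0] over the
    planes [(E_i, J E_i)] gives the divergence of each row of [b]. *)
Lemma divergence_antiinv (b : @kform R 5 2) x :
  (forall x, multilinear_alternating (b x)) ->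
  (forall A, smooth_fun (fun x => b x A)) -> ext_d b = 0 ->
  (forall x u v, b x (two_vectors (u *m Jmat x) (v *m Jmat x)) = - b x (two_vectors u v)) ->
  forall j : 'I_6, \sum_(k < 6) frame_derive k (comp2 b k j) x =
    match nat_of_ord j with
    | 4 => comp2 b 1 3 x - comp2 b 0 2 x
    | 5 => - comp2 b 0 3 x - comp2 b 1 2 x
    | _ => 0
    end.
Proof.
move=> mb sb db hb.
have hb' x0 u v : b x0 (two_vectors (u *m Jmat x0) (v *m Jmat x0)) = -1 * b x0 (two_vectors u v).
  by rewrite mulN1r.
have rel y := comp2_J mb hb' y.
have r45 : comp2 b 4 5 = comp2 b 0 1 by apply/funext => y; have [[]] := rel y; lra.
have r35 : comp2 b 3 5 = comp2 b 0 2 by apply/funext => y; have [[]] := rel y; lra.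
have r34 : comp2 b 3 4 = comp2 b 1 2 by apply/funext => y; have [_ []] := rel y; lra.
have r15 : comp2 b 1 5 = fun y => -1 * comp2 b 0 4 y by apply/funext => y; have [[]] := rel y; lra.
have r25 : comp2 b 2 5 = fun y => -1 * comp2 b 0 3 y by apply/funext => y; have [_ []] := rel y; lra.
have r24 : comp2 b 2 4 = fun y => -1 * comp2 b 1 3 y by apply/funext => y; have [_ []] := rel y; lra.
have r05 : comp2 b 0 5 = fun=> 0 by apply/funext => y; have [_ _ []] := rel y; lra.
have r14 : comp2 b 1 4 = fun=> 0 by apply/funext => y; have [_ _ []] := rel y; lra.
have r23 : comp2 b 2 3 = fun=> 0 by apply/funext => y; have [_ _ []] := rel y; lra.
have sc i j : smooth_fun (comp2 b i j) by exact: smooth_comp2.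
have an i j : b x (two_vectors (frame_vec i x) (frame_vec j x)) = comp2 b i j x by [].
pose simp := (ml2_oppl (mb x), ml2_oppr (mb x), ml2_0l (mb x), ml2_0r (mb x), an,
  r45, r35, r34, r15, r25, r24, r05, r14, r23, frame_derive_cst).
have e44 : comp2 b 4 4 x = 0 by exact: comp2_diag.
have e55 : comp2 b 5 5 x = 0 by exact: comp2_diag.
have anti i j : comp2 b i j x = - comp2 b j i x by exact: comp2_antisym.
have fanti k i j : frame_derive k (comp2 b i j) x = - frame_derive k (comp2 b j i) x.
  rewrite -mulN1r -frame_deriveZ //; congr frame_derive.
  by apply/funext => y; rewrite mulN1r; exact: comp2_antisym.
have fdiag k i : frame_derive k (comp2 b i i) x = 0.
  by rewrite (_ : comp2 b i i = fun=> 0) ?frame_derive_cst //; apply/funext => y; exact: comp2_diag.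
move=> j; rewrite sum6 !inordK //; move: j.
apply: ord6_ind; rewrite inordK // ?fdiag.
- rewrite (fanti _ 1 0)%N (fanti _ 2 0)%N (fanti _ 3 0)%N (fanti _ 4 0)%N (fanti _ 5 0)%N !simp.
  have := closed_comp2 1 4 5 x mb sb db; rewrite !(@connectionE R _ _ x) // !simp ?frame_deriveZ // => H1.
  have := closed_comp2 2 3 5 x mb sb db; rewrite !(@connectionE R _ _ x) // !simp ?frame_deriveZ // => H2.
  move: H1 H2 e44 e55; linear_in_components.
- rewrite (fanti _ 2 1)%N (fanti _ 3 1)%N (fanti _ 4 1)%N (fanti _ 5 1)%N !simp ?frame_deriveZ //.
  have := closed_comp2 0 4 5 x mb sb db; rewrite !(@connectionE R _ _ x) // !simp ?frame_deriveZ // => H1.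
  have := closed_comp2 2 3 4 x mb sb db; rewrite !(@connectionE R _ _ x) // !simp ?frame_deriveZ // => H2.
  move: H1 H2 e44 e55; linear_in_components.
- rewrite (fanti _ 3 2)%N (fanti _ 4 2)%N (fanti _ 5 2)%N !simp ?frame_deriveZ //.
  have := closed_comp2 0 3 5 x mb sb db; rewrite !(@connectionE R _ _ x) // !simp ?frame_deriveZ // => H1.
  have := closed_comp2 1 3 4 x mb sb db; rewrite !(@connectionE R _ _ x) // !simp ?frame_deriveZ // => H2.
  move: H1 H2 e44 e55; linear_in_components.
- rewrite (fanti _ 4 3)%N (fanti _ 5 3)%N !simp ?frame_deriveZ //.
  have := closed_comp2 0 2 5 x mb sb db; rewrite !(@connectionE R _ _ x) // !simp ?frame_deriveZ // => H1.
  have := closed_comp2 1 2 4 x mb sb db; rewrite !(@connectionE R _ _ x) // !simp ?frame_deriveZ // => H2.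
  have := anti 5%N 4%N; rewrite r45 => H3.
  move: H1 H2 H3 e44 e55; linear_in_components.
- rewrite (fanti _ 5 4)%N !simp ?frame_deriveZ //.
  have := closed_comp2 0 1 5 x mb sb db; rewrite !(@connectionE R _ _ x) // !simp ?frame_deriveZ // => H1.
  have := closed_comp2 1 2 3 x mb sb db; rewrite !(@connectionE R _ _ x) // !simp ?frame_deriveZ // => H2.
  have := anti 5%N 3%N; rewrite r35 => H3.
  move: H1 H2 H3 e44 e55; linear_in_components.
- rewrite  !simp ?frame_deriveZ //.
  have := closed_comp2 0 1 4 x mb sb db; rewrite !(@connectionE R _ _ x) // !simp ?frame_deriveZ // => H1.
  have := closed_comp2 0 2 3 x mb sb db; rewrite !(@connectionE R _ _ x) // !simp ?frame_deriveZ // => H2.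
  have := anti 4%N 3%N; rewrite r34 => H3.
  move: H1 H2 H3 e44 e55; linear_in_components.
Qed.

(** For [b] coclosed, the frame components of the field with divergence
    [<b, d c>]. *)
Definition contraction (b : @kform R 5 2) (c : @kform R 5 1) (k : nat) (y : V) : R :=
  \sum_(j < 6) comp2 b k j y * comp1 c j y.

Lemma smooth_contraction b c k : (forall i j, smooth_fun (comp2 b i j)) ->
  (forall i, smooth_fun (comp1 c i)) -> smooth_fun (contraction b c k).
Proof. by move=> sb sc; apply: smooth_sum => j; exact: smooth_mul. Qed.

Lemma frame_derive_contraction b c k x : (forall i j, smooth_fun (comp2 b i j)) ->
  (forall i, smooth_fun (comp1 c i)) -> frame_derive k (contraction b c k) x =
  \sum_(j < 6) (frame_derive k (comp2 b k j) x * comp1 c j x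
                + comp2 b k j x * frame_derive k (comp1 c j) x).
Proof.
move=> sb sc; rewrite frame_derive_sum => [|j]; last exact: smooth_mul.
by apply: eq_bigr => j _; rewrite frame_deriveM.
Qed.

(** [J] preserves the inner product of two-forms, and multiplies that of [a] and [b]
    by -1. *)
Lemma inv_antiinv_orthogonal (a b : @kform R 5 2) x :
  (forall x, multilinear_alternating (a x)) -> (forall x, multilinear_alternating (b x)) ->
  (forall x u v, a x (two_vectors (u *m Jmat x) (v *m Jmat x)) = a x (two_vectors u v)) ->
  (forall x u v, b x (two_vectors (u *m Jmat x) (v *m Jmat x)) = - b x (two_vectors u v)) ->
  \sum_(k < 6) \sum_(j < 6) comp2 b k j x * comp2 a k j x = 0.
Proof.
move=> ma mb ha hb.
have [[a45 a15 a35] [a25 a34 a24] _] := @comp2_J a 1 ma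
  (fun x u v => etrans (ha x u v) (esym (mul1r _))) x.
have [[b45 b15 b35] [b25 b34 b24] [b05 b14 b23]] := @comp2_J b (-1) mb
  (fun x u v => etrans (hb x u v) (esym (mulN1r _))) x.
have b05' : comp2 b 0 5 x = 0 by move: b05; linear_in_components.
have b14' : comp2 b 1 4 x = 0 by move: b14; linear_in_components.
have b23' : comp2 b 2 3 x = 0 by move: b23; linear_in_components.
have an i j := comp2_antisym mb i j x; have dg i := comp2_diag mb i x.
have ana i j := comp2_antisym ma i j x.
rewrite sum6 !sum6 !inordK // !dg.
rewrite (an 1 0)%N (an 2 0)%N (an 3 0)%N (an 4 0)%N (an 5 0)%N (an 2 1)%N (an 3 1)%N
  (an 4 1)%N (an 5 1)%N (an 3 2)%N (an 4 2)%N (an 5 2)%N (an 4 3)%N (an 5 3)%N (an 5 4)%N.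
rewrite (ana 1 0)%N (ana 2 0)%N (ana 3 0)%N (ana 4 0)%N (ana 5 0)%N (ana 2 1)%N (ana 3 1)%N
  (ana 4 1)%N (ana 5 1)%N (ana 3 2)%N (ana 4 2)%N (ana 5 2)%N (ana 4 3)%N (ana 5 3)%N (ana 5 4)%N.
rewrite b05' b14' b23' a45 a15 a35 a25 a34 a24 b45 b15 b35 b25 b34 b24.
ring_in_components.
Qed.

(** Pointwise energy identity: for [b] closed of type (2,0)+(0,2) and
    cohomologous to [a] of type (1,1) through [d c], [|b|^2 = <b, d c>] is a
    divergence because [b] is coclosed. *)
Lemma energy_identity (a b : @kform R 5 2) (c : @kform R 5 1) x :
  (forall x, multilinear_alternating (a x)) ->
  (forall x, multilinear_alternating (b x)) ->
  (forall x, multilinear_alternating (c x)) ->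
  (forall A, smooth_fun (fun x => b x A)) -> (forall A, smooth_fun (fun x => c x A)) ->
  ext_d b = 0 ->
  (forall x u v, a x (two_vectors (u *m Jmat x) (v *m Jmat x)) = a x (two_vectors u v)) ->
  (forall x u v, b x (two_vectors (u *m Jmat x) (v *m Jmat x)) = - b x (two_vectors u v)) ->
  b = a + ext_d c ->
  \sum_(k < 6) \sum_(j < 6) comp2 b k j x ^+ 2
  = \sum_(k < 6) 2 * frame_derive k (contraction b c k) x.
Proof.
move=> ma mb mc sb sc db ha hb bac.
pose G k j := frame_derive k (comp1 c j) x - c x (connection k j).
have E k j : comp2 b k j x ^+ 2 =
    comp2 b k j x * comp2 a k j x + comp2 b k j x * (G k j - G j k).
  rewrite -mulrDr expr2; congr (_ * _); rewrite {1}/comp2 bac; congr (_ + _).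
  by rewrite cartan1 // /G; ring.
under eq_bigr do (under eq_bigr do rewrite E; rewrite big_split).
rewrite big_split /= inv_antiinv_orthogonal // add0r.
have sb2 i j : smooth_fun (comp2 b i j) by exact: smooth_comp2.
have sc1 i : smooth_fun (comp1 c i) by exact: smooth_comp1.
under [in RHS]eq_bigr do rewrite frame_derive_contraction // big_split mulrDr.
rewrite [RHS]big_split /= -2!mulr_sumr.
rewrite [X in _ = 2 * X + _]exchange_big /=.
under [X in _ = 2 * X + _]eq_bigr do rewrite -mulr_suml divergence_antiinv //.
have sw (F : nat -> nat -> R) : \sum_(k < 6) \sum_(j < 6) comp2 b k j x * (F k j - F j k) =
    2 * \sum_(k < 6) \sum_(j < 6) comp2 b k j x * F k j.
  have -> : \sum_(k < 6) \sum_(j < 6) comp2 b k j x * (F k j - F j k) =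
    \sum_(k < 6) \sum_(j < 6) comp2 b k j x * F k j - \sum_(k < 6) \sum_(j < 6) comp2 b k j x * F j k.
    rewrite -sumrB; apply: eq_bigr => k _; rewrite -sumrB; apply: eq_bigr => j _.
    by rewrite mulrBr.
  rewrite [X in _ - X]exchange_big /= [X in _ - X](_ : _ = - \sum_(k < 6) \sum_(j < 6) comp2 b k j x * F k j).
    by rewrite opprK -mulr2n mulr_natl.
  rewrite -sumrN; apply: eq_bigr => k _; rewrite -sumrN; apply: eq_bigr => j _.
  by rewrite comp2_antisym // mulNr.
rewrite sw -mulrDr; congr (_ * _); rewrite /G.
transitivity (\sum_(k < 6) \sum_(j < 6) comp2 b k j x * frame_derive k (comp1 c j) x
    - \sum_(k < 6) \sum_(j < 6) comp2 b k j x * c x (connection k j)).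
  rewrite -sumrB; apply: eq_bigr => k _; rewrite -sumrB; apply: eq_bigr => j _.
  by rewrite mulrBr.
rewrite addrC; congr (_ + _).
rewrite sum6 !sum6 !inordK //= !(@connectionE R _ _ x) //.
have c0 : c x 0 = 0 by have := ml1_lin 0 0 0 0 (mc x); rewrite !scale0r addr0 !mul0r addr0.
have cN v : c x (- v) = - c x v.
  by have := ml1_lin (-1) 0 v 0 (mc x); rewrite scale0r addr0 mul0r addr0 scaleN1r mulN1r.
rewrite ?cN !c0 -!/(comp1 c _ x).
ring_in_components.
Qed.

Lemma null_mean_sum6 (h : nat -> V -> R) : (forall k, (k < 6)%N -> null_mean (h k)) ->
  null_mean (fun x => \sum_(k < 6) h k x).
Proof.
move=> nh; rewrite (_ : (fun x => _) = fun x =>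
    h 0%N x + h 1%N x + h 2%N x + h 3%N x + h 4%N x + h 5%N x).
  by do ![apply: null_meanD]; exact: nh.
by apply/funext => x; rewrite sum6 !inordK.
Qed.

(** The squared norm of [b] is nonnegative with zero integral, by
    [energy_identity] and the divergence theorem. *)
Lemma antiinv_cohomologous_inv_eq0 (a b : @kform R 5 2) (c : @kform R 5 1) :
  kforms iwasawa_deck a -> closed_form iwasawa_deck b -> kforms iwasawa_deck c ->
  (forall x u v, a x (two_vectors (u *m Jmat x) (v *m Jmat x)) = a x (two_vectors u v)) ->
  (forall x u v, b x (two_vectors (u *m Jmat x) (v *m Jmat x)) = - b x (two_vectors u v)) ->
  b = a + ext_d c -> b = 0.
Proof.
move=> [ma [sa ia]] [kb db] kc ha hb bac.
have [mb [sb ib]] := kb; have [mc [sc ic]] := kc.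
pose en x := \sum_(k < 6) \sum_(j < 6) comp2 b k j x ^+ 2.
have en0 x : 0 <= en x by apply: sumr_ge0 => k _; apply: sumr_ge0 => j _; exact: sqr_ge0.
have sb2 i j : smooth_fun (comp2 b i j) by exact: smooth_comp2.
have sc1 i : smooth_fun (comp1 c i) by exact: smooth_comp1.
have sen : smooth_fun en.
  by apply: smooth_sum => k; apply: smooth_sum => j; exact: smooth_mul.
have ien : deck_invariant en.
  move=> t Zt x; apply: eq_bigr => k _; apply: eq_bigr => j _.
  by rewrite deck_invariant_comp2.
have nen : null_mean en.
  rewrite (_ : en = fun x => \sum_(k < 6) 2 * frame_derive k (contraction b c k) x).
    apply: (@null_mean_sum6 (fun k x => 2 * frame_derive k (contraction b c k) x)) => k k6.
    apply: null_meanZ; apply: null_mean_frame_derive => //; first exact: smooth_contraction.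
    move=> t Zt x; apply: eq_bigr => j _.
    by rewrite deck_invariant_comp2 // deck_invariant_comp1.
  by apply/funext => x; apply: (@energy_identity a).
apply/funext => x; apply: (comp2_eq0 mb) => i j ij.
have i6 : (i < 6)%N by lia.
have j6 : (j < 6)%N by lia.
have := null_mean_eq0 sen ien en0 nen x.
move/eqP; rewrite psumr_eq0 => [/allP /(_ (inord i))|k _]; last first.
  by apply: sumr_ge0 => l _; exact: sqr_ge0.
rewrite mem_index_enum => /(_ isT) /=; rewrite psumr_eq0 => [/allP /(_ (inord j))|k _]; last exact: sqr_ge0.
by rewrite mem_index_enum => /(_ isT) /=; rewrite sqrf_eq0 !inordK // => /eqP.
Qed.

Lemma Jmat_pure : Cinf_pure iwasawa_deck Jmat.
Proof.
have k0 k : kforms iwasawa_deck (0 : @kform R 5 k).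
  split; first by split=> *; rewrite ?mulr0 ?addr0.
  by split=> [A|F _]; [exact: smooth_cst|].
have d0 : ext_d (0 : @kform R 5 2) = 0.
  apply/funext => x; apply/funext => A; rewrite /ext_d big1 // => i _.
  by rewrite derive_cst mulr0.
have ce0 k x A : @ceval R 5 k (realform 0) x A = 0 :> R[i].
  by rewrite /ceval /complexify !big1 ?mulr0 ?addr0 // => S _; rewrite mulr0.
apply/seteqP; split=> [C [[a [[ka da] ta] <-] [b [[kb db] tb] ba]]|C ->].
  have bda : dR_class iwasawa_deck a b.
    rewrite -ba; exists 0; first exact: k0.
    rewrite (_ : ext_d 0 = 0) ?addr0 //; apply/funext => x; apply/funext => A.
    by rewrite /ext_d big1 // => i _; rewrite derive_cst mulr0.
  have [c kc bac] := bda.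
  have b0 : b = 0.
    apply: (@antiinv_cohomologous_inv_eq0 a b c) => // x u v.
      exact: (forms11_inv Jmat_sqr u v (ka.1 x) ta).
    exact: (forms20_02_antiinv Jmat_sqr u v (kb.1 x) tb).
  by rewrite -ba b0.
have c0 : closed_form iwasawa_deck (0 : @kform R 5 2) by split.
have f0 p q : @forms_pq R 5 iwasawa_deck Jmat p q (realform 0).
  by split=> [|x A S _ _]; [split; exact: k0|exact: ce0].
split; exists 0 => //; split=> //.
exists (realform 0), (realform 0); split; [exact: (f0 2%N 0%N)|exact: (f0 0%N 2%N)|].
by rewrite /realform /= addr0.
Qed.

(** Because [[E_0, E_2] = E_4], the equation [d a = 0] on [(E_0, E_2, E_5)] makes the
    component [a_45] a divergence, and likewise for [b]; moreover [a_01 = - a_45] and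
    [b_01 = b_45] by the types.  Since [[E_0, E_1] = 0], the components of [d c1] and
    [d c2] on [(E_0, E_1)] are divergences too. *)
Lemma not_sum_of_types (e a b : @kform R 5 2) (c1 c2 : @kform R 5 1) :
  (forall x, comp2 e 0 1 x = 1) ->
  closed_form iwasawa_deck a -> closed_form iwasawa_deck b ->
  kforms iwasawa_deck c1 -> kforms iwasawa_deck c2 ->
  (forall x u v, a x (two_vectors (u *m Jmat x) (v *m Jmat x)) = a x (two_vectors u v)) ->
  (forall x u v, b x (two_vectors (u *m Jmat x) (v *m Jmat x)) = - b x (two_vectors u v)) ->
  e <> (a + ext_d c1) + (b + ext_d c2).
Proof.
move=> e1 ca cb kc1 kc2 ha hb eE.
have nd f : closed_form iwasawa_deck f -> null_mean (@comp2 R f 4 5).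
  move=> [kf df]; have [mf [sf _]] := kf.
  rewrite (_ : comp2 f 4 5 = fun x => frame_derive 0 (comp2 f 2 5) x +
     -1 * frame_derive 2 (comp2 f 0 5) x + frame_derive 5 (comp2 f 0 2) x).
    by do ![apply: null_meanD]; try apply: null_meanZ; apply: null_mean_frame_derive => //;
      try exact: smooth_comp2; exact: deck_invariant_comp2.
  apply/funext => x; have := closed_comp2 0 2 5 x mf sf df; rewrite !(@connectionE R _ _ x) //.
  rewrite !(ml2_0l (mf x)) !(ml2_0r (mf x)) -!/(comp2 f _ _ x).
  linear_in_components.
have nc c : kforms iwasawa_deck c ->
    null_mean (fun x => ext_d c x (two_vectors (frame_vec 0 x) (frame_vec 1 x)) : R).
  move=> kc; have [mc [sc _]] := kc.
  rewrite (_ : (fun x => _) = fun x => frame_derive 0 (comp1 c 1) x +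
     -1 * frame_derive 1 (comp1 c 0) x).
    by apply: null_meanD; try apply: null_meanZ; apply: null_mean_frame_derive => //;
      try exact: smooth_comp1; exact: deck_invariant_comp1.
  by apply/funext => x; rewrite cartan1 // !(@connectionE R _ _ x) // subrr subr0 mulN1r.
suff /null_mean_cst_eq0/eqP : null_mean (fun _ : V => 1 : R) by rewrite oner_eq0.
rewrite (_ : (fun=> 1) = fun x => -1 * comp2 a 4 5 x + ext_d c1 x (two_vectors (frame_vec 0 x) (frame_vec 1 x))
    + (comp2 b 4 5 x + ext_d c2 x (two_vectors (frame_vec 0 x) (frame_vec 1 x)))).
  by do ![apply: null_meanD]; try apply: null_meanZ; try exact: nd; exact: nc.
apply/funext => x; rewrite -[LHS](e1 x) {1}/comp2 eE.
have [[a45 _ _] _ _] := @comp2_J a 1 ca.1.1 (fun x u v => etrans (ha x u v) (esym (mul1r _))) x.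
have [[b45 _ _] _ _] := @comp2_J b (-1) cb.1.1 (fun x u v => etrans (hb x u v) (esym (mulN1r _))) x.
by rewrite a45 b45 opprK mul1r !mulN1r opprK.
Qed.

Lemma Jmat_not_full (e : @kform R 5 2) : closed_form iwasawa_deck e ->
  (forall x, comp2 e 0 1 x = 1) -> ~ Cinf_full iwasawa_deck Jmat.
Proof.
move=> ce e1 full.
have : @dR_cohomology R 5 iwasawa_deck 1 (dR_class iwasawa_deck e) by exists e.
rewrite full => -[C1 [a [ca ta] <-]] [C2 [b [cb tb] <-]] Ce.
have : dR_class iwasawa_deck e e.
  exists 0.
    split; first by split=> *; rewrite ?mulr0 ?addr0.
    by split=> [A|F _]; [exact: smooth_cst|].
  rewrite (_ : ext_d 0 = 0) ?addr0 //; apply/funext => x; apply/funext => A.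
  by rewrite /ext_d big1 // => i _; rewrite derive_cst mulr0.
rewrite -Ce => -[_ [c1 kc1 ->]] [_ [c2 kc2 ->]] eE.
apply: (@not_sum_of_types e a b c1 c2) => // x u v.
  exact: (forms11_inv Jmat_sqr u v (ca.1.1 x) ta).
exact: (forms20_02_antiinv Jmat_sqr u v (cb.1.1 x) tb).
Qed.

End PureNotFull.

(** * The almost-Kaehler structure *)

Section AlmostKahler.
Context {R : realType}.
Notation V := 'rV[R]_6.
Implicit Types (x y u v w : V).

Definition cols (k : nat) (s : seq nat) (i : 'I_k) : 'I_6 := inord (nth 0%N s i).

(** [eform k s] is the left-invariant form [e^s_0 /\ ... /\ e^s_(k-1)]. *)
Definition eform (k : nat) (s : seq nat) : @kform R 5 k :=
  fun x A => \det (colsub (@cols k s) (A *m coframe x)).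
Arguments eform k s : clear implicits.

Lemma det_mx22 (A : 'M[R]_2) : \det A = A 0 0 * A 1 1 - A 0 1 * A 1 0.
Proof.
rewrite (expand_det_row _ 0) !big_ord_recl big_ord0 addr0 /cofactor !det_mx11 !mxE /=.
rewrite expr0 expr1 mulN1r mul1r mulrN.
by congr (_ * _ - _ * _); congr (A _ _); apply: val_inj.
Qed.

Lemma eform2E i j x u v : eform 2%N [:: i; j] x (two_vectors u v) =
  coord (u *m coframe x) i * coord (v *m coframe x) j
  - coord (u *m coframe x) j * coord (v *m coframe x) i.
Proof.
rewrite /eform det_mx22 mulmx_two.
have e0 p q k : (two_vectors p q : 'M[R]_(2, 6)) 0 k = p 0 k.
  by have := congr1 (fun M : V => M 0 k) (row0_two p q); rewrite mxE.
have e1 p q k : (two_vectors p q : 'M[R]_(2, 6)) 1 k = q 0 k.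
  by have := congr1 (fun M : V => M 0 k) (row1_two p q); rewrite mxE.
have cE (M : 'M[R]_(2, 6)) p q : colsub (@cols 2 [:: i; j]) M p q = M p (@cols 2 [:: i; j] q).
  by rewrite mxE.
by rewrite !cE !e0 !e1.
Qed.

Lemma eform_ml k s x : multilinear_alternating (eform k s x).
Proof.
split=> [A B C i b c rA rB rC|A i j ij rA]; rewrite /eform -!mulmx_colsub.
  apply: (determinant_multilinear (i0 := i)).
  - by rewrite !row_mul rA mulmxDl -!scalemxAl.
  - by rewrite !row'Esub -!mul_rowsub_mx -!row'Esub rB.
  - by rewrite !row'Esub -!mul_rowsub_mx -!row'Esub rC.
apply: (determinant_alternate ij) => l.
by have := congr1 (fun M : V => M *m colsub (@cols k s) (coframe x)) rA; rewrite -!row_mul => /rowP /(_ l); rewrite !mxE.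
Qed.

Lemma smooth_coframe (i j : 'I_6) : smooth_fun (fun x : V => coframe x i j).
Proof.
rewrite (_ : (fun x => _) = fun x => (1%:M : 'M[R]_6) i j - nilp x i j).
  by apply: smooth_sub; [exact: smooth_cst|exact: smooth_nilp].
by apply/funext => x; rewrite !mxE.
Qed.

Lemma smooth_frame (i j : 'I_6) : smooth_fun (fun x : V => frame x i j).
Proof.
rewrite (_ : (fun x => _) = fun x => (1%:M : 'M[R]_6) i j + nilp x i j).
  by apply: smooth_add; [exact: smooth_cst|exact: smooth_nilp].
by apply/funext => x; rewrite !mxE.
Qed.

Lemma eform_smooth k s A : smooth_fun (fun x => eform k s x A).
Proof.
apply: smooth_det => i j.
rewrite (_ : (fun x => _) = fun x => \sum_l A i l * coframe x l (@cols k s j)).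
  by apply: smooth_sum => l; apply: smooth_mul; [exact: smooth_cst|exact: smooth_coframe].
by apply/funext => x; rewrite !mxE.
Qed.

Lemma kforms_deck k (b : @kform R 5 k) :
  (forall x, multilinear_alternating (b x)) -> (forall A, smooth_fun (fun x => b x A)) ->
  (forall t x A, b (ltrans t x) (A *m frame t) = b x A) -> kforms iwasawa_deck b.
Proof.
move=> mb sb ib; split=> //; split=> // F /iwasawa_deckP[t _ ->].
by apply/funext => x; apply/funext => A; rewrite pullback_ltrans.
Qed.

Lemma kforms_eform k s : kforms iwasawa_deck (eform k s).
Proof.
apply: kforms_deck; [exact: eform_ml|exact: eform_smooth|move=> t x A].
by rewrite /eform -mulmxA coframe_ltrans.
Qed.

Lemma kformsD k (a b : @kform R 5 k) G : kforms G a -> kforms G b -> kforms G (a + b).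
Proof.
move=> [ma [sa ia]] [mb [sb ib]]; split=> [x|].
  split=> [A B C i s t rA rB rC|A i j ij rA].
    rewrite [LHS](congr2 _ ((ma x).1 _ _ _ _ _ _ rA rB rC) ((mb x).1 _ _ _ _ _ _ rA rB rC)).
    by rewrite (_ : (a + b) x B = a x B + b x B) // (_ : (a + b) x C = a x C + b x C) //; ring.
  by rewrite [LHS](congr2 _ ((ma x).2 _ _ _ ij rA) ((mb x).2 _ _ _ ij rA)) addr0.
split=> [A|F GF]; first exact: smooth_add.
by rewrite -[in RHS](ia F GF) -[in RHS](ib F GF).
Qed.

Definition omega : @kform R 5 2 :=
  eform 2%N [:: 0; 5]%N + eform 2%N [:: 1; 4]%N + eform 2%N [:: 2; 3]%N.

Lemma kforms_omega : kforms iwasawa_deck omega.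
Proof. by do ![apply: kformsD]; exact: kforms_eform. Qed.

Lemma omegaE x u v : omega x (two_vectors u v) =
  let u' := u *m coframe x in let v' := v *m coframe x in
  coord u' 0 * coord v' 5 - coord u' 5 * coord v' 0
  + (coord u' 1 * coord v' 4 - coord u' 4 * coord v' 1)
  + (coord u' 2 * coord v' 3 - coord u' 3 * coord v' 2).
Proof. by rewrite /= -!eform2E. Qed.

Definition gmat x : 'M[R]_6 := coframe x *m (coframe x)^T.

Lemma dotgE x u v : dotg gmat x u v = \sum_i (u *m coframe x) 0 i * (v *m coframe x) 0 i.
Proof.
rewrite /dotg /gmat mulmxA -mulmxA -trmx_mul mxE.
by apply: eq_bigr => i _; rewrite [_^T _ _]mxE.
Qed.

Lemma coord_coframe x u k : (k < 6)%N -> coord (u *m coframe x) k = coord u k -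
  match k with
  | 4 => coord u 2 * coord x 0 - coord u 3 * coord x 1
  | 5 => coord u 2 * coord x 1 + coord u 3 * coord x 0
  | _ => 0 end.
Proof. by move=> k6; rewrite /coframe mulmxBr mulmx1 coordD coordN coord_nilp. Qed.

Lemma coord_Jstd u k : (k < 6)%N -> coord (u *m Jstd) k =
  match k with
  | 0 => - coord u 5 | 1 => - coord u 4 | 2 => - coord u 3
  | 3 => coord u 2 | 4 => coord u 1 | _ => coord u 0 end.
Proof.
move=> k6; rewrite {1}/coord mxE sum6 !mxE !inordK //.
by move: k k6 => [|[|[|[|[|[|//]]]]]] _ /=; rewrite /coord; ring.
Qed.

Lemma Jmat_coframe x u : u *m Jmat x *m coframe x = (u *m coframe x) *m Jstd.
Proof. by rewrite /Jmat -!mulmxA frameK mulmx1. Qed.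

(** [omega] is affine in the base point: only [e^4] and [e^5] vary, and no term
    of [omega] contains both. *)
Lemma derive_omega x u v w : 'D_w (fun y => omega y (two_vectors u v)) x =
  - (coord u 0 * (coord v 2 * coord w 1 + coord v 3 * coord w 0)
     - (coord u 2 * coord w 1 + coord u 3 * coord w 0) * coord v 0
     + (coord u 1 * (coord v 2 * coord w 0 - coord v 3 * coord w 1)
     - (coord u 2 * coord w 0 - coord u 3 * coord w 1) * coord v 1)).
Proof.
apply: (@derive_val _ _ _ _ _ _ _ (is_derive_affine _)) => t.
by rewrite !omegaE /= !coord_coframe // !coordD !coordZ /GRing.scale /=; ring.
Qed.

Lemma three_vectorsE (A : 'M[R]_(3, 6)) : A = three_vectors (row 0 A) (row 1 A) (row (inord 2) A).
Proof.
apply/row_matrixP => i; have [|[]] : i = 0 \/ i = 1 \/ i = inord 2.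
- case: i => -[|[|[|//]]] ?; [left|right; left|right; right]; apply: val_inj => //=.
  by rewrite inordK.
- by move=> ->; rewrite row0_three.
- by move=> ->; rewrite row1_three.
- by move=> ->; rewrite row2_three.
Qed.

Lemma omega_closed : ext_d omega = 0.
Proof.
apply/funext => x; apply/funext => A; rewrite [A]three_vectorsE ext_d_2form !derive_omega.
rewrite [RHS](_ : _ = 0) //; ring.
Qed.

(** In the frame [omega] has the matrix [Jstd], which is orthogonal. *)
Lemma omega_J x u v : omega x (two_vectors u (v *m Jmat x)) = dotg gmat x u v.
Proof.
rewrite omegaE dotgE /= Jmat_coframe sum6 !coord_Jstd // -!/(coord _ _); ring.
Qed.

Lemma dotg_gt0 x u : u != 0 -> 0 < dotg gmat x u u.
Proof.
move=> u0; rewrite dotgE lt_neqAle sumr_ge0 ?andbT => [|i _]; last by rewrite -expr2 sqr_ge0.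
apply: contraNneq u0 => /esym/eqP; rewrite psumr_eq0 => [/allP u0|i _]; last by rewrite -expr2 sqr_ge0.
rewrite -[u]mulmx1 -(coframeK x) mulmxA (_ : u *m coframe x = 0) ?mul0mx //.
apply/rowP => i; have := u0 i; rewrite mem_index_enum => /(_ isT) /=.
by rewrite mulf_eq0 orbb => /eqP ->; rewrite mxE.
Qed.

Lemma Jmat_almost_Kahler : almost_Kahler iwasawa_deck Jmat omega gmat.
Proof.
have dE (F : V -> V) : iwasawa_deck F -> exists t, F = ltrans t.
  by case/iwasawa_deckP => t _ ->; exists t.
split.
- split; first exact: Jmat_sqr.
  split=> [i j|F /dE[t ->] x v].
    rewrite (_ : (fun x => _) = fun x => \sum_k (\sum_l coframe x i l * Jstd l k) * frame x k j).
      apply: smooth_sum => k; apply: smooth_mul; last exact: smooth_frame.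
      apply: smooth_sum => l; apply: smooth_mul; [exact: smooth_coframe|exact: smooth_cst].
    by apply/funext => x; rewrite !mxE; apply: eq_bigr => k _; rewrite mxE.
  rewrite !diff_ltrans /Jmat !mulmxA -[v *m frame t *m _]mulmxA coframe_ltrans.
  by rewrite -[LHS]mulmxA frame_ltrans.
- split; first by split; [exact: kforms_omega|exact: omega_closed].
  move=> x u u0; apply/eqP; apply: contraT => /(dotg_gt0 x).
  by rewrite -omega_J u0 ltxx.
- split=> [i j|].
    rewrite (_ : (fun x => _) = fun x => \sum_k coframe x i k * coframe x j k).
      by apply: smooth_sum => k; apply: smooth_mul; exact: smooth_coframe.
    by apply/funext => x; rewrite mxE; apply: eq_bigr => k _; rewrite [_^T _ _]mxE.
  split=> [x u v|]; first by rewrite !dotgE; apply: eq_bigr => k _; rewrite mulrC.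
  split=> [x u|F /dE[t ->] x u v]; first exact: dotg_gt0.
  by rewrite !dotgE !diff_ltrans -!mulmxA coframe_ltrans.
- move=> x u v; rewrite !dotgE !Jmat_coframe !sum6 -!/(coord _ _) !coord_Jstd //; ring.
- by move=> x u v; rewrite omega_J.
Qed.

End AlmostKahler.
Arguments eform {R} k s : rename.

(** * The Hodge star in the frame *)

Section Expansion.
Context {R : realType}.

Definition cons_row m k (u : 'rV[R]_m) (M : 'M[R]_(k, m)) : 'M[R]_(k.+1, m) :=
  \matrix_(i, j) if unlift ord0 i is Some i' then M i' j else u 0 j.

Lemma cons_row0 m k u (M : 'M[R]_(k, m)) : row ord0 (cons_row u M) = u.
Proof. by apply/rowP => j; rewrite !mxE unlift_none. Qed.

Lemma cons_rowS m k u (M : 'M[R]_(k, m)) i : row (lift ord0 i) (cons_row u M) = row i M.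
Proof. by apply/rowP => j; rewrite !mxE liftK. Qed.

Lemma row'_cons_row m k u (M : 'M[R]_(k, m)) : row' ord0 (cons_row u M) = M.
Proof. by apply/matrixP => i j; rewrite !mxE liftK. Qed.

Lemma cons_rowE m k (M : 'M[R]_(k.+1, m)) : M = cons_row (row ord0 M) (row' ord0 M).
Proof.
by apply/matrixP => i j; rewrite !mxE; case: unliftP => [i' ->|->]; rewrite ?mxE.
Qed.

Definition row_linear k m (D : 'M[R]_(k, m) -> R) : Prop :=
  forall (A B C : 'M[R]_(k, m)) i b c,
    row i A = b *: row i B + c *: row i C ->
    row' i B = row' i A -> row' i C = row' i A -> D A = b * D B + c * D C.

Lemma row'_consS m k u (M N : 'M[R]_(k, m)) i :
  row' i M = row' i N -> row' (lift ord0 i) (cons_row u M) = row' (lift ord0 i) (cons_row u N).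
Proof.
move=> /row'_eq MN; apply/matrixP => p j; rewrite !mxE.
case: unliftP => [q E|//]; apply: MN; rewrite inE.
by apply: contraTneq (neq_lift (lift ord0 i) p) => qi; rewrite E qi eqxx.
Qed.

(** Induction on the number of rows, expanding the first one. *)
Lemma row_linear_expand k m (D : 'M[R]_(k, m) -> R) M : row_linear D ->
  D M = \sum_(f : {ffun 'I_k -> 'I_m}) (\prod_i M i (f i)) * D (rowsub f 1%:M).
Proof.
elim: k D M => [|k IH] D M hD.
  rewrite (eq_bigr (fun=> D M)) => [|f _].
    by rewrite sumr_const card_ffun !card_ord expn0 mulr1n.
  by rewrite big_ord0 mul1r; congr D; apply/matrixP => -[].
have lin1 N : forall u, D (cons_row u N) = \sum_j u 0 j * D (cons_row (delta_mx 0 j) N).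
  have step b c u v : D (cons_row (b *: u + c *: v) N) = b * D (cons_row u N) + c * D (cons_row v N).
    by apply: (hD _ _ _ ord0); rewrite ?cons_row0 ?row'_cons_row.
  have D0 : D (cons_row 0 N) = 0.
    by have := step 0 0 0 0; rewrite !scale0r addr0 !mul0r addr0.
  move=> u; rewrite {1}[u]row_sum_delta; elim/big_rec2 : _ => [//|j y z _ E].
  by rewrite -[X in cons_row (_ + X)]scale1r step mul1r E.
have IHj u : D (cons_row u (row' ord0 M)) =
    \sum_(f : {ffun 'I_k -> 'I_m}) (\prod_i M (lift ord0 i) (f i)) * D (cons_row u (rowsub f 1%:M)).
  rewrite (IH (fun N => D (cons_row u N))) => [|A B C i b c rA rB rC].
    by apply: eq_bigr => f _; congr (_ * _); apply: eq_bigr => i _; rewrite mxE.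
  by apply: (hD _ _ _ (lift ord0 i)); rewrite ?cons_rowS //; exact: row'_consS.
rewrite {1}[M]cons_rowE lin1.
under eq_bigr do rewrite IHj mulr_sumr.
rewrite pair_big /=.
pose h (p : 'I_m * {ffun 'I_k -> 'I_m}) : {ffun 'I_k.+1 -> 'I_m} :=
  [ffun i => if unlift ord0 i is Some i' then p.2 i' else p.1].
pose h' (f : {ffun 'I_k.+1 -> 'I_m}) : 'I_m * {ffun 'I_k -> 'I_m} :=
  (f ord0, [ffun i => f (lift ord0 i)]).
rewrite [RHS](reindex h) /=; last first.
  exists h' => [[j f] _|f _].
    by rewrite /h' /h ffunE unlift_none; congr pair; apply/ffunP => i; rewrite !ffunE liftK.
  by apply/ffunP => i; rewrite !ffunE; case: unliftP => [i' ->|->]; rewrite ?ffunE.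
apply: eq_bigr => -[j f] _ /=.
rewrite big_ord_recl ffunE unlift_none mulrA mxE; congr (_ * _ * _).
  by apply: eq_bigr => i _; rewrite ffunE liftK.
congr D; apply/matrixP => i l; rewrite !mxE ffunE; case: unliftP => [i' _|_]; rewrite ?mxE ?eqxx 1?eq_sym //.
Qed.

Lemma det_col_mx_linear k l (B : 'M[R]_(l, k + l)) : row_linear (fun M => \det (col_mx M B)).
Proof.
have r' (M N : 'M[R]_(k, k + l)) i : row' i M = row' i N ->
    row' (lshift l i) (col_mx M B) = row' (lshift l i) (col_mx N B).
  move=> /row'_eq MN; apply/matrixP => p q; rewrite [LHS]mxE [RHS]mxE [LHS]mxE [RHS]mxE.
  case: splitP => // r E; apply: MN; rewrite inE.
  apply: contraTneq (neq_lift (lshift l i) p) => ri.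
  by apply/negPn/eqP/ord_inj; rewrite E ri.
move=> A C D i b c rA rC rD; apply: (determinant_multilinear (i0 := lshift l i)); try exact: r'.
by rewrite !rowKu.
Qed.

(** Permuting the upper rows is multiplication by a block-diagonal permutation
    matrix. *)
Lemma det_col_mx_perm k l (s : 'S_k) (M : 'M[R]_(k, k + l)) B :
  \det (col_mx (row_perm s M) B) = (-1) ^+ s * \det (col_mx M B).
Proof.
rewrite -det_perm row_permE.
have -> : col_mx (perm_mx s *m M) B = block_mx (perm_mx s) 0 0 1%:M *m col_mx M B.
  by rewrite mul_block_col !mul0mx mul1mx addr0 add0r.
by rewrite det_mulmx det_ublock det1 mulr1.
Qed.

(** When the degrees add up to the dimension, the padding in [hodge_star] is only a
    change of index type. *)
Lemma conform_col_mx k l m (e : (k + l)%N = m) (M : 'M[R]_(k, m)) (B : 'M[R]_(l, m)) :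
  conform_mx (0 : 'M[R]_m) (col_mx M B) = castmx (e, erefl m) (col_mx M B).
Proof. by case: _ / e M B => M B; rewrite conform_mx_id castmx_id. Qed.

Lemma det_cast_linear k l m (e : (k + l)%N = m) (B : 'M[R]_(l, m)) :
  row_linear (fun M => \det (castmx (e, erefl m) (col_mx M B))).
Proof.
case: _ / e B => B A C D i b c rA rC rD; rewrite !castmx_id.
by have := @det_col_mx_linear k l B A C D i b c rA rC rD.
Qed.

Lemma det_cast_perm k l m (e : (k + l)%N = m) (s : 'S_k) (M : 'M[R]_(k, m)) (B : 'M[R]_(l, m)) :
  \det (castmx (e, erefl m) (col_mx (row_perm s M) B))
  = (-1) ^+ s * \det (castmx (e, erefl m) (col_mx M B)).
Proof. by case: _ / e M B => M B; rewrite !castmx_id; exact: det_col_mx_perm. Qed.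

End Expansion.

Section Hodge.
Context {R : realType}.
Notation V := 'rV[R]_6.
Implicit Types (x y u v w : V).

Lemma gmat_inv x : invmx (gmat x) = (frame x)^T *m frame x.
Proof.
have E : ((frame x)^T *m frame x) *m gmat x = 1%:M.
  by rewrite /gmat -mulmxA (mulmxA (frame x)) frameK mul1mx -trmx_mul coframeK trmx1.
have gu : gmat x \in unitmx by have /mulmx1_unit[] := E.
by rewrite -[LHS]mul1mx -E mulmxK.
Qed.

Lemma det_coframe x : \det (coframe x) = 1 :> R.
Proof.
have := congr1 determinant (frameK x); rewrite det_mulmx det_frame det1 mul1r; exact.
Qed.

Lemma det_gmat x : \det (gmat x) = 1.
Proof. by rewrite /gmat det_mulmx det_tr det_coframe mulr1. Qed.

(** The metric and the volume form are standard in the frame, so that [* e^c] is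
    the volume form with the frame vectors [E_c] in the first slots.  The sum over
    the indices in [hodge_star] is the multilinear expansion of that determinant,
    once for each term of the determinant [e^c]; the [k!] terms are equal. *)
Lemma hodge_star_eform k l s x (e : (k + l)%N = 6%N) (B : 'M[R]_(l, 6)) :
  hodge_star gmat (eform k s) x B =
  \det (castmx (e, erefl) (col_mx (rowsub (@cols k s) (frame x)) B)).
Proof.
pose D (M : 'M[R]_(k, 6)) := \det (castmx (e, erefl) (col_mx M B)).
have Dlin : row_linear D by exact: det_cast_linear.
have Dperm t M : D (row_perm t M) = (-1) ^+ t * D M by exact: det_cast_perm.
rewrite -/(D _) /hodge_star det_gmat sqrtr1 gmat_inv.
under eq_bigr do rewrite conform_col_mx mul1r -/(D _).
pose c := @cols k s.
have aE (f : 'I_k -> 'I_6) : eform k s x (rowsub f ((frame x)^T *m frame x)) =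
    \sum_(t : 'S_k) (-1) ^+ t * \prod_i frame x (c (t i)) (f i).
  rewrite /eform -mul_rowsub_mx -mulmxA frameK mulmx1 /determinant; apply: eq_bigr => t _.
  by congr (_ * _); apply: eq_bigr => i _; rewrite !mxE.
under eq_bigr do rewrite aE mulr_suml.
rewrite exchange_big /=.
rewrite (eq_bigr (fun=> D (rowsub c (frame x)))) => [|t _].
  rewrite sumr_const card_Sn -[D _ *+ _]mulr_natl mulrA mulVf ?mul1r //.
transitivity ((-1) ^+ t * D (row_perm t (rowsub c (frame x)))).
  rewrite [D (row_perm _ _)](row_linear_expand _ Dlin) mulr_sumr; apply: eq_bigr => f _.
  rewrite -mulrA; congr (_ * (_ * _)); apply: eq_bigr => i _; by rewrite !mxE.
by rewrite Dperm mulrA -expr2 sqrr_sign mul1r.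
Qed.

End Hodge.

(** * The Hodge star of the invariant forms *)

Section SmallDet.
Context {R : realType}.
Implicit Types F : nat -> nat -> R.

(** With natural numbers as indices the minors have the same shape as the matrix,
    so that expansions can be iterated. *)
Lemma det_nat_expand n F :
  \det (\matrix_(i < n.+1, k < n.+1) F i k) =
  \sum_(j < n.+1) (-1) ^+ j * F 0%N j * \det (\matrix_(i < n, k < n) F i.+1 (bump j k)).
Proof.
rewrite (expand_det_row _ ord0); apply: eq_bigr => j _.
rewrite mxE /cofactor add0n mulrA [F _ _ * _]mulrC; congr (_ * \det _).
by apply/matrixP => i k; rewrite !mxE.
Qed.

Lemma det_nat_unit_row n F j : (j <= n)%N ->
  (forall k, (k <= n)%N -> F 0%N k = (k == j)%:R) ->
  \det (\matrix_(i < n.+1, k < n.+1) F i k) =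
  (-1) ^+ j * \det (\matrix_(i < n, k < n) F i.+1 (bump j k)).
Proof.
move=> jn F0; rewrite det_nat_expand (bigD1 (inord j)) //= big1 => [|i ij].
  by rewrite addr0 inordK // F0 // eqxx mulr1.
rewrite F0 -1?ltnS // (_ : (_ == j) = false) ?mulr0 ?mul0r //.
by apply: contraNF ij => /eqP E; apply/eqP/val_inj; rewrite /= inordK.
Qed.

Lemma det_nat2 F : \det (\matrix_(i < 2, k < 2) F i k) =
  F 0%N 0%N * F 1%N 1%N - F 0%N 1%N * F 1%N 0%N.
Proof.
by rewrite (@det_nat_expand 1) !big_ord_recl big_ord0 !det_mx11 !mxE /bump /=; ring.
Qed.

Lemma det_nat3 F : \det (\matrix_(i < 3, k < 3) F i k) =
  F 0%N 0%N * (F 1%N 1%N * F 2%N 2%N - F 1%N 2%N * F 2%N 1%N)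
  - F 0%N 1%N * (F 1%N 0%N * F 2%N 2%N - F 1%N 2%N * F 2%N 0%N)
  + F 0%N 2%N * (F 1%N 0%N * F 2%N 1%N - F 1%N 1%N * F 2%N 0%N).
Proof.
rewrite (@det_nat_expand 2).
under eq_bigr => j _ do rewrite (det_nat2 (fun i k => F i.+1 (bump j k))).
by rewrite !big_ord_recl big_ord0 /bump /=; ring.
Qed.

Lemma det_nat4 F : \det (\matrix_(i < 4, k < 4) F i k) =
  F 0%N 0%N * (F 1%N 1%N * (F 2%N 2%N * F 3%N 3%N - F 2%N 3%N * F 3%N 2%N)
     - F 1%N 2%N * (F 2%N 1%N * F 3%N 3%N - F 2%N 3%N * F 3%N 1%N)
     + F 1%N 3%N * (F 2%N 1%N * F 3%N 2%N - F 2%N 2%N * F 3%N 1%N))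
  - F 0%N 1%N * (F 1%N 0%N * (F 2%N 2%N * F 3%N 3%N - F 2%N 3%N * F 3%N 2%N)
     - F 1%N 2%N * (F 2%N 0%N * F 3%N 3%N - F 2%N 3%N * F 3%N 0%N)
     + F 1%N 3%N * (F 2%N 0%N * F 3%N 2%N - F 2%N 2%N * F 3%N 0%N))
  + F 0%N 2%N * (F 1%N 0%N * (F 2%N 1%N * F 3%N 3%N - F 2%N 3%N * F 3%N 1%N)
     - F 1%N 1%N * (F 2%N 0%N * F 3%N 3%N - F 2%N 3%N * F 3%N 0%N)
     + F 1%N 3%N * (F 2%N 0%N * F 3%N 1%N - F 2%N 1%N * F 3%N 0%N))
  - F 0%N 3%N * (F 1%N 0%N * (F 2%N 1%N * F 3%N 2%N - F 2%N 2%N * F 3%N 1%N)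
     - F 1%N 1%N * (F 2%N 0%N * F 3%N 2%N - F 2%N 2%N * F 3%N 0%N)
     + F 1%N 2%N * (F 2%N 0%N * F 3%N 1%N - F 2%N 1%N * F 3%N 0%N)).
Proof.
rewrite (@det_nat_expand 3).
under eq_bigr => j _ do rewrite (det_nat3 (fun i k => F i.+1 (bump j k))).
by rewrite !big_ord_recl big_ord0 /bump /=; ring.
Qed.

End SmallDet.

Section HodgeConcrete.
Context {R : realType}.
Notation V := 'rV[R]_6.
Implicit Types (x y u v w : V).

Lemma det_castM k l m (e : (k + l)%N = m) (M : 'M[R]_(k, m)) (B : 'M[R]_(l, m)) (Q : 'M[R]_m) :
  \det (castmx (e, erefl m) (col_mx M B)) * \det Q =
  \det (castmx (e, erefl m) (col_mx (M *m Q) (B *m Q))).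
Proof. by case: _ / e M B Q => M B Q; rewrite !castmx_id -det_mulmx mul_col_mx. Qed.

(** Passing to frame coordinates multiplies by [coframe x], of determinant 1. *)
Lemma det_frame_rows k l (e : (k + l)%N = 6%N) (c : 'I_k -> 'I_6) x (B : 'M[R]_(l, 6)) :
  \det (castmx (e, erefl) (col_mx (rowsub c (frame x)) B)) =
  \det (castmx (e, erefl) (col_mx (rowsub c 1%:M) (B *m coframe x))).
Proof.
by rewrite -[LHS]mulr1 -[X in _ * X](det_coframe x) det_castM mul_rowsub_mx frameK.
Qed.

(** The matrix [col_mx (rowsub (cols s) 1%:M) C] with natural numbers as indices, so
    that its unit rows can be expanded in turn. *)
Definition bordered (k : nat) (s : seq nat) (l : nat) (C : 'M[R]_(l.+1, 6)) (i j : nat) : R :=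
  if (i < k)%N then (j == nth 0%N s i)%:R else C (inord (i - k)) (inord j).

Lemma det_bordered k l (e : (k + l.+1)%N = 6%N) s (C : 'M[R]_(l.+1, 6)) :
  all (fun c => c < 6)%N s ->
  \det (castmx (e, erefl) (col_mx (rowsub (@cols k s) 1%:M) C)) =
  \det (\matrix_(i < 6, j < 6) bordered k s C i j).
Proof.
move=> s6; congr (\det _); apply/matrixP => i j; rewrite castmxE !mxE cast_ord_id /bordered.
have c6 p : (nth 0%N s p < 6)%N.
  have [ps|ps] := ltnP p (size s); last by rewrite nth_default.
  exact: (allP s6 _ (mem_nth _ ps)).
case: splitP => p /= ->; rewrite ?ltn_ord ?mxE.
  by rewrite -val_eqE /= inordK // eq_sym.
by rewrite ltnNge leq_addr /= addKn !inord_val.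
Qed.

Lemma eform_nat k s x (A : 'M[R]_(k.+1, 6)) : eform k.+1 s x A =
  \det (\matrix_(i < k.+1, j < k.+1)
     (fun i j => (A *m coframe x) (inord i) (inord (nth 0%N s j))) i j).
Proof.
by congr (\det _); apply/matrixP => i j; rewrite !mxE inord_val.
Qed.

Ltac small_cases := do 7! case=> //.

(** [* e^c] is the form on the complementary indices, up to the sign of the shuffle,
    which is even here and in the next four lemmas; the unit rows of the determinant
    are expanded in turn. *)
Lemma hodge_star_e025 x B : hodge_star gmat (eform 3 [:: 0; 2; 5]%N) x B = eform 3 [:: 1; 3; 4]%N x B.
Proof.
rewrite (@hodge_star_eform R 3 3 _ x erefl) det_frame_rows det_bordered // eform_nat.
set C := B *m _; pose F := bordered 3 [:: 0; 2; 5]%N C.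
rewrite (@det_nat_unit_row R 5 F 0) //; try by small_cases.
rewrite (@det_nat_unit_row R 4 (fun i k => F i.+1 (bump 0 k)) 1) //; try by small_cases.
rewrite (@det_nat_unit_row R 3 (fun i k => F i.+2 (bump 0 (bump 1 k))) 3) //; try by small_cases.
rewrite (det_nat3 (fun i k => F i.+3 (bump 0 (bump 1 (bump 3 k))))).
rewrite (det_nat3 (fun i j => C (inord i) (inord (nth 0%N [:: 1; 3; 4]%N j)))).
by rewrite /F /bordered /bump /=; ring.
Qed.

Lemma hodge_star_e135 x B : hodge_star gmat (eform 3 [:: 1; 3; 5]%N) x B = eform 3 [:: 0; 2; 4]%N x B.
Proof.
rewrite (@hodge_star_eform R 3 3 _ x erefl) det_frame_rows det_bordered // eform_nat.
set C := B *m _; pose F := bordered 3 [:: 1; 3; 5]%N C.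
rewrite (@det_nat_unit_row R 5 F 1) //; try by small_cases.
rewrite (@det_nat_unit_row R 4 (fun i k => F i.+1 (bump 1 k)) 2) //; try by small_cases.
rewrite (@det_nat_unit_row R 3 (fun i k => F i.+2 (bump 1 (bump 2 k))) 3) //; try by small_cases.
rewrite (det_nat3 (fun i k => F i.+3 (bump 1 (bump 2 (bump 3 k))))).
rewrite (det_nat3 (fun i j => C (inord i) (inord (nth 0%N [:: 0; 2; 4]%N j)))).
by rewrite /F /bordered /bump /=; ring.
Qed.

Lemma hodge_star_e034 x B : hodge_star gmat (eform 3 [:: 0; 3; 4]%N) x B = eform 3 [:: 1; 2; 5]%N x B.
Proof.
rewrite (@hodge_star_eform R 3 3 _ x erefl) det_frame_rows det_bordered // eform_nat.
set C := B *m _; pose F := bordered 3 [:: 0; 3; 4]%N C.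
rewrite (@det_nat_unit_row R 5 F 0) //; try by small_cases.
rewrite (@det_nat_unit_row R 4 (fun i k => F i.+1 (bump 0 k)) 2) //; try by small_cases.
rewrite (@det_nat_unit_row R 3 (fun i k => F i.+2 (bump 0 (bump 2 k))) 2) //; try by small_cases.
rewrite (det_nat3 (fun i k => F i.+3 (bump 0 (bump 2 (bump 2 k))))).
rewrite (det_nat3 (fun i j => C (inord i) (inord (nth 0%N [:: 1; 2; 5]%N j)))).
by rewrite /F /bordered /bump /=; ring.
Qed.

Lemma hodge_star_e124 x B : hodge_star gmat (eform 3 [:: 1; 2; 4]%N) x B = eform 3 [:: 0; 3; 5]%N x B.
Proof.
rewrite (@hodge_star_eform R 3 3 _ x erefl) det_frame_rows det_bordered // eform_nat.
set C := B *m _; pose F := bordered 3 [:: 1; 2; 4]%N C.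
rewrite (@det_nat_unit_row R 5 F 1) //; try by small_cases.
rewrite (@det_nat_unit_row R 4 (fun i k => F i.+1 (bump 1 k)) 1) //; try by small_cases.
rewrite (@det_nat_unit_row R 3 (fun i k => F i.+2 (bump 1 (bump 1 k))) 2) //; try by small_cases.
rewrite (det_nat3 (fun i k => F i.+3 (bump 1 (bump 1 (bump 2 k))))).
rewrite (det_nat3 (fun i j => C (inord i) (inord (nth 0%N [:: 0; 3; 5]%N j)))).
by rewrite /F /bordered /bump /=; ring.
Qed.

Lemma hodge_star_e0123 x B :
  hodge_star gmat (eform 4 [:: 0; 1; 2; 3]%N) x B = eform 2 [:: 4; 5]%N x B.
Proof.
rewrite (@hodge_star_eform R 4 2 _ x erefl) det_frame_rows det_bordered // eform_nat.
set C := B *m _; pose F := bordered 4 [:: 0; 1; 2; 3]%N C.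
rewrite (@det_nat_unit_row R 5 F 0) //; try by small_cases.
rewrite (@det_nat_unit_row R 4 (fun i k => F i.+1 (bump 0 k)) 0) //; try by small_cases.
rewrite (@det_nat_unit_row R 3 (fun i k => F i.+2 (bump 0 (bump 0 k))) 0) //; try by small_cases.
rewrite (@det_nat_unit_row R 2 (fun i k => F i.+3 (bump 0 (bump 0 (bump 0 k)))) 0) //;
  try by small_cases.
rewrite (det_nat2 (fun i k => F i.+4 (bump 0 (bump 0 (bump 0 (bump 0 k)))))).
rewrite (det_nat2 (fun i j => C (inord i) (inord (nth 0%N [:: 4; 5]%N j)))).
by rewrite /F /bordered /bump /=; ring.
Qed.

End HodgeConcrete.

(** * The product with the symplectic form *)

Section Lefschetz.
Context {R : realType}.
Notation V := 'rV[R]_6.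
Implicit Types (x y u v w : V).

Lemma eform3E a b c x u v w : eform 3 [:: a; b; c] x (three_vectors u v w) =
  let u' := coord (u *m coframe x) in let v' := coord (v *m coframe x) in
  let w' := coord (w *m coframe x) in
  u' a * (v' b * w' c - v' c * w' b) - u' b * (v' a * w' c - v' c * w' a)
  + u' c * (v' a * w' b - v' b * w' a).
Proof.
rewrite eform_nat (det_nat3 (fun i j => (_ *m coframe x) (inord i) (inord (nth 0%N [:: a; b; c] j)))).
have rE (p : 'I_3) q : (three_vectors u v w *m coframe x) p (inord q) =
    coord (row p (three_vectors u v w) *m coframe x) q.
  by rewrite -row_mul /coord [RHS]mxE.
have i0 : inord 0 = 0 :> 'I_3 by apply: val_inj; rewrite /= inordK.
have i1 : inord 1 = 1 :> 'I_3 by apply: val_inj; rewrite /= inordK.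
by rewrite !rE i0 i1 row0_three row1_three row2_three.
Qed.

(** From [d e^4 = - e^02 + e^13] and [d e^5 = - e^03 - e^12]. *)
Lemma ext_d_e45 : ext_d (eform 2 [:: 4; 5]%N) =
  (fun x A => - eform 3 [:: 0; 2; 5]%N x A + eform 3 [:: 1; 3; 5]%N x A
   + eform 3 [:: 0; 3; 4]%N x A + eform 3 [:: 1; 2; 4]%N x A) :> @kform R 5 3.
Proof.
have dE u v w x : 'D_w (fun y => eform 2 [:: 4; 5]%N y (two_vectors u v)) x =
    - coord (u *m nilp w) 4 * coord (v *m coframe x) 5
    - coord (u *m coframe x) 4 * coord (v *m nilp w) 5
    + coord (u *m nilp w) 5 * coord (v *m coframe x) 4
    + coord (u *m coframe x) 5 * coord (v *m nilp w) 4.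
  have dc p k : is_derive x w (fun y => coord (p *m coframe y) k) (- coord (p *m nilp w) k).
    apply: is_derive_affine => t.
    by rewrite /coframe !mulmxBr nilpD nilpZ mulmxDr -scalemxAr !(coordD, coordN, coordZ) /GRing.scale /=; ring.
  rewrite (_ : (fun y => _) = fun y => coord (u *m coframe y) 4 * coord (v *m coframe y) 5
     + - (coord (u *m coframe y) 5 * coord (v *m coframe y) 4)).
    have H := is_derive_add (is_derive_mul (dc u 4%N) (dc v 5%N))
      (is_derive_opp (is_derive_mul (dc u 5%N) (dc v 4%N))).
    by rewrite (@derive_val _ _ _ _ _ _ _ H); ring.
  by apply/funext => y; rewrite eform2E.
apply/funext => x; apply/funext => A; rewrite [A]three_vectorsE ext_d_2form !dE !eform3E /=.
rewrite !coord_nilp // !coord_coframe //; ring.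
Qed.

(** The twelve terms are those of [omega /\ e^01]; the ones with a repeated column
    vanish, and the other four equal [E 0 1 2 3] up to the sign of the column
    permutation. *)
Lemma det_shuffle (C : nat -> nat -> R) (E := fun a b c d : nat =>
    \det (\matrix_(i < 4, j < 4) (fun i j => C i (nth 0%N [:: a; b; c; d] j)) i j)) :
  E 0 5 0 1 - E 5 0 0 1 + E 1 4 0 1 - E 4 1 0 1 + E 2 3 0 1 - E 3 2 0 1
  - E 0 5 1 0 + E 5 0 1 0 - E 1 4 1 0 + E 4 1 1 0 - E 2 3 1 0 + E 3 2 1 0 = 4 * E 0 1 2 3.
Proof.
have nE (a b c d : nat) := det_nat4 (fun i j => C i (nth 0%N [:: a; b; c; d] j)).
by rewrite /E !nE /=; ring.
Qed.

(** Each product of components, summed over the permutations with signs, is the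
    Leibniz expansion of a determinant of columns. *)
Lemma omega_wedge_e01 : lefschetz omega (eform 2 [:: 0; 1]%N) =
  eform 4 [:: 0; 1; 2; 3]%N :> @kform R 5 4.
Proof.
apply/funext => x; apply/funext => A; rewrite /lefschetz /wedge_form.
pose C (p : 'I_4) (k : nat) := coord (row p A *m coframe x) k.
pose E a b c d : R :=
  \det (\matrix_(i < 4, j < 4) (fun i j => C (inord i) (nth 0%N [:: a; b; c; d] j)) i j).
pose i0 : 'I_4 := inord 0. pose i1 : 'I_4 := inord 1.
pose i2 : 'I_4 := inord 2. pose i3 : 'I_4 := inord 3.
have ER a b c d : E a b c d = \sum_(s : 'S_4)
    (-1) ^+ s * (C (s i0) a * C (s i1) b * C (s i2) c * C (s i3) d).
  rewrite /E -det_tr /determinant; apply: eq_bigr => s _; congr (_ * _).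
  rewrite !big_ord_recr big_ord0 /= mul1r !mxE !inord_val.
  by congr (C (s _) _ * C (s _) _ * C (s _) _ * C (s _) _); apply: val_inj; rewrite /= inordK.
have rows (M : 'M[R]_(2, 6)) : M = two_vectors (row 0 M) (row 1 M) by exact: two_vectorsE.
have rU (s : 'S_4) (i : 'I_2) : row i (usubmx (row_perm s A : 'M[R]_(2 + 2, 6))) = row (s (inord i)) A.
  rewrite (_ : inord i = lshift 2 i :> 'I_4); last by apply: val_inj; rewrite /= inordK //; case: i => -[|[]].
  by apply/rowP => j; rewrite !mxE.
have rD (s : 'S_4) (i : 'I_2) : row i (dsubmx (row_perm s A : 'M[R]_(2 + 2, 6))) = row (s (inord (2 + i))) A.
  rewrite (_ : inord _ = rshift 2 i :> 'I_4); last by apply: val_inj; rewrite /= inordK //; case: i => -[|[]].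
  by apply/rowP => j; rewrite !mxE.
have omE s : omega x (@usubmx R 2 2 6 (row_perm s A)) =
    C (s i0) 0 * C (s i1) 5 - C (s i0) 5 * C (s i1) 0
    + (C (s i0) 1 * C (s i1) 4 - C (s i0) 4 * C (s i1) 1)
    + (C (s i0) 2 * C (s i1) 3 - C (s i0) 3 * C (s i1) 2).
  by rewrite (rows (@usubmx R 2 2 6 _)) omegaE /= !rU.
have alE s : eform 2 [:: 0; 1]%N x (@dsubmx R 2 2 6 (row_perm s A)) =
    C (s i2) 0 * C (s i3) 1 - C (s i2) 1 * C (s i3) 0.
  by rewrite (rows (@dsubmx R 2 2 6 _)) eform2E /= !rD.
have eE : eform 4 [:: 0; 1; 2; 3]%N x A = E 0 1 2 3.
  rewrite eform_nat; congr (\det _); apply/matrixP => i j; rewrite [LHS]mxE [RHS]mxE.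
  by rewrite /C -row_mul /coord [RHS]mxE.
have shuffle : E 0 5 0 1 - E 5 0 0 1 + E 1 4 0 1 - E 4 1 0 1 + E 2 3 0 1 - E 3 2 0 1
  - E 0 5 1 0 + E 5 0 1 0 - E 1 4 1 0 + E 4 1 1 0 - E 2 3 1 0 + E 3 2 1 0 = 4 * E 0 1 2 3.
  exact: (det_shuffle (fun i => C (inord i))).
rewrite eE -[RHS](@mulKf R 4) // -shuffle; congr (_ * _).
rewrite !ER -!sumrN -!big_split /=; apply: eq_bigr => s _.
rewrite omE alE; clearbody C.
move: ((-1) ^+ s) (s i0) (s i1) (s i2) (s i3) => e p0 p1 p2 p3; ring.
Qed.

End Lefschetz.

(** * Harmonic forms *)

Section Final.
Context {R : realType}.
Notation V := 'rV[R]_6.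
Implicit Types (x y u v w : V).

Lemma ext_d_const k (a : @kform R 5 k) : (forall x y A, a x A = a y A) -> ext_d a = 0.
Proof.
move=> ac; apply/funext => x; apply/funext => A; rewrite /ext_d big1 // => i _.
rewrite (_ : (fun y => _) = fun=> a 0 (row' i A)) ?derive_cst ?mulr0 //.
by apply/funext => y; exact: ac.
Qed.

Lemma hodge_star0 k l : hodge_star gmat (0 : @kform R 5 k) = 0 :> @kform R 5 l.
Proof.
apply/funext => x; apply/funext => A; rewrite /hodge_star big1 ?mulr0 // => f _.
by rewrite mul0r.
Qed.

Lemma codiff0 k : codiff gmat (0 : @kform R 5 k.+1) = 0.
Proof.
by apply/funext => x; apply/funext => A; rewrite /codiff hodge_star0 ext_d_const // hodge_star0 mulr0.
Qed.

(** [e^0, ..., e^3] are the coordinate forms. *)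
Lemma eform_const k s : all (fun c => c < 4)%N s ->
  forall x y A, eform k s x A = eform k s y A :> R.
Proof.
move=> s4 x y A.
have c4 p : (nth 0%N s p < 4)%N.
  have [ps|ps] := ltnP p (size s); last by rewrite nth_default.
  exact: (allP s4 _ (mem_nth _ ps)).
have cE z i j : (j < 4)%N -> (A *m coframe z) i (inord j) = A i (inord j).
  move=> j4; have j6 : (j < 6)%N by lia.
  transitivity (coord (row i A *m coframe z) j).
    by rewrite -row_mul /coord [RHS]mxE.
  rewrite coord_coframe // (_ : match j with 4 => _ | 5 => _ | _ => _ end = 0).
    by rewrite subr0 /coord mxE.
  by move: j j4 {j6} => [|[|[|[|]]]].
by congr (\det _); apply/matrixP => i j; rewrite [LHS]mxE [RHS]mxE !cE.
Qed.

Lemma hodge_star_eform_const x y (B : 'M[R]_(4, 6)) :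
  hodge_star gmat (eform 2 [:: 0; 1]%N) x B = hodge_star gmat (eform 2 [:: 0; 1]%N) y B.
Proof.
rewrite !(@hodge_star_eform R 2 4 _ _ erefl).
have fE z : rowsub (@cols 2 [:: 0; 1]%N) (frame z) = rowsub (@cols 2 [:: 0; 1]%N) 1%:M.
  apply/matrixP => i j; rewrite !mxE /cols inordK; last by case: i => -[|[|]].
  by case: i => -[|[|//]] i2 /=; rewrite addr0.
by rewrite !fE.
Qed.

(** Both [e^01] and its Hodge dual have constant coefficients. *)
Lemma e01_harmonic : harmonic_form iwasawa_deck gmat (eform 2 [:: 0; 1]%N : @kform R 5 2).
Proof.
split; first exact: kforms_eform.
rewrite /hodge_laplacian (ext_d_const (@eform_const 2 [:: 0; 1]%N isT)) codiff0 addr0.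
rewrite (_ : codiff gmat _ = 0); first exact: ext_d_const.
apply/funext => x; apply/funext => A; rewrite /codiff.
rewrite (ext_d_const (a := hodge_star gmat _)); last exact: hodge_star_eform_const.
by rewrite hodge_star0 mulr0.
Qed.

Lemma codiff_e0123 : codiff gmat (eform 4 [:: 0; 1; 2; 3]%N) = (fun x A =>
  eform 3 [:: 1; 3; 4]%N x A - eform 3 [:: 0; 2; 4]%N x A
  - eform 3 [:: 1; 2; 5]%N x A - eform 3 [:: 0; 3; 5]%N x A) :> @kform R 5 3.
Proof.
have hE : hodge_star gmat (eform 4 [:: 0; 1; 2; 3]%N) = eform 2 [:: 4; 5]%N :> @kform R 5 2.
  by apply/funext => x; apply/funext => B; exact: hodge_star_e0123.
apply/funext => x; apply/funext => A; rewrite /codiff.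
rewrite -[X in (-1) ^+ X]/31%N (_ : (-1) ^+ 31 = -1 :> R); last by rewrite -signr_odd /= expr1.
rewrite -[(5.+1 - 4)%N]/2%N hE ext_d_e45 mulN1r.
rewrite -hodge_star_e025 -hodge_star_e135 -hodge_star_e034 -hodge_star_e124 /hodge_star.
rewrite -!mulrBr -mulrN; congr (_ * _); rewrite -sumrN -!sumrB; apply: eq_bigr => f _.
by ring.
Qed.

(** Evaluation at the origin on the first four coordinate vectors gives 4: of the
    four terms of the exterior derivative, the first two are equal to 2 and the
    others vanish. *)
Lemma hodge_laplacian_e0123_neq0 :
  hodge_laplacian gmat (eform 4 [:: 0; 1; 2; 3]%N) <> 0 :> @kform R 5 4.
Proof.
rewrite /hodge_laplacian codiff_e0123 (ext_d_const (@eform_const 4 [:: 0; 1; 2; 3]%N isT)).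
rewrite codiff0 addr0 => /(congr1 (fun a : kform 4 => a 0 (\matrix_(i, j) (i == j :> nat)%:R))).
rewrite /ext_d.
pose A : 'M[R]_(4, 6) := \matrix_(i, j) (i == j :> nat)%:R.
rewrite -/A.
have rA (i : 'I_4) : row i A = basisv i.
  by apply/rowP => j; rewrite !mxE eqxx /= -val_eqE /= inordK; [rewrite eq_sym|case: i => i /= i4; lia].
have r' (i : 'I_4) (a b c : 'I_4) : lift i 0 = a -> lift i 1 = b -> lift i (inord 2) = c ->
    row' i A = three_vectors (basisv a) (basisv b) (basisv c).
  by move=> <- <- <-; rewrite [LHS]three_vectorsE row'Esub !row_rowsub !rA.
pose f y B : R := eform 3 [:: 1; 3; 4]%N y B - eform 3 [:: 0; 2; 4]%N y B
  - eform 3 [:: 1; 2; 5]%N y B - eform 3 [:: 0; 3; 5]%N y B.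
have f0 y : f y (three_vectors (basisv 1) (basisv 2) (basisv 3)) = 2 * coord y 0.
  by rewrite /f !eform3E /= !coord_coframe // !coord_basisv //=; ring.
have f1 y : f y (three_vectors (basisv 0) (basisv 2) (basisv 3)) = - 2 * coord y 1.
  by rewrite /f !eform3E /= !coord_coframe // !coord_basisv //=; ring.
have f2 y : f y (three_vectors (basisv 0) (basisv 1) (basisv 3)) = 0.
  by rewrite /f !eform3E /= !coord_coframe // !coord_basisv //=; ring.
have f3 y : f y (three_vectors (basisv 0) (basisv 1) (basisv 2)) = 0.
  by rewrite /f !eform3E /= !coord_coframe // !coord_basisv //=; ring.
have Df (s : R) k w : 'D_w (fun y : V => s * coord y k) 0 = s * coord w k.
  have H : is_derive (0 : V) w (fun y : V => s * coord y k) (s * coord w k).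
    by apply: is_derive_affine => t; rewrite coordD coordZ /GRing.scale /=; ring.
  exact: derive_val.
have row'A (i a b c : nat) : (i < 4)%N -> (a < 4)%N -> (b < 4)%N -> (c < 4)%N ->
    bump i 0 = a -> bump i 1 = b -> bump i 2 = c ->
    row' (inord i) A = three_vectors (basisv a) (basisv b) (basisv c).
  move=> i4 a4 b4 c4 ia ib ic.
  rewrite (r' (inord i) (inord a) (inord b) (inord c)) ?inordK //.
  - by apply: val_inj; rewrite /= !inordK.
  - by apply: val_inj; rewrite /= !inordK.
  - by apply: val_inj; rewrite /= !inordK.
have sum4 (F : 'I_4 -> R) : \sum_j F j = F (inord 0) + F (inord 1) + F (inord 2) + F (inord 3).
  rewrite !big_ord_recr big_ord0 /= add0r.
  by do ![congr (_ + _)]; congr F; apply: val_inj; rewrite /= ?inordK.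
rewrite sum4 !rA !inordK // (row'A 0 1 2 3)%N // (row'A 1 0 2 3)%N // (row'A 2 0 1 3)%N //.
rewrite (row'A 3 0 1 2)%N //.
have b1 k : (k < 6)%N -> coord (basisv k : V) k = 1.
  by move=> k6; rewrite coord_basisv // eqxx.
have E0 : 'D_(basisv 0) (fun y => f y (three_vectors (basisv 1) (basisv 2) (basisv 3))) 0 = 2.
  by rewrite (funext f0) Df b1 // mulr1.
have E1 : 'D_(basisv 1) (fun y => f y (three_vectors (basisv 0) (basisv 2) (basisv 3))) 0 = - 2.
  by rewrite (funext f1) Df b1 // mulr1.
have E2 : 'D_(basisv 2) (fun y => f y (three_vectors (basisv 0) (basisv 1) (basisv 3))) 0 = 0.
  by rewrite (funext f2); exact: derive_cst.
have E3 : 'D_(basisv 3) (fun y => f y (three_vectors (basisv 0) (basisv 1) (basisv 2))) 0 = 0.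
  by rewrite (funext f3); exact: derive_cst.
rewrite /f in E0 E1 E2 E3; rewrite E0 E1 E2 E3 (_ : (0 : @kform R 5 4) 0 A = 0) //.
by clear; move=> H; lra.
Qed.

End Final.

Theorem proposition4p1 (R : realType) :
  exists (J : 'rV[R]_6 -> 'M[R]_6) (omega : @kform R 5 2)
         (g : 'rV[R]_6 -> 'M[R]_6),
    [/\ almost_Kahler iwasawa_deck J omega g,
        Cinf_pure iwasawa_deck J,
        ~ Cinf_full iwasawa_deck J &
        exists alpha : @kform R 5 2,
          harmonic_form iwasawa_deck g alpha /\
          ~ harmonic_form iwasawa_deck g (lefschetz omega alpha)].
Proof.
exists Jmat, omega, gmat; split.
- exact: Jmat_almost_Kahler.
- exact: Jmat_pure.
- apply: (@Jmat_not_full R (eform 2 [:: 0; 1]%N)).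
    by split; [exact: kforms_eform|apply: ext_d_const; exact: eform_const].
  move=> x; rewrite /comp2 eform2E /frame_vec -!row_mul frameK /coord !mxE -!val_eqE /= !inordK //.
  by rewrite mulr1 mulr0 subr0.
- exists (eform 2 [:: 0; 1]%N); split; first exact: e01_harmonic.
  by rewrite omega_wedge_e01 => -[_]; exact: hodge_laplacian_e0123_neq0.
Qed.
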